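(* Suppose that $G$ is consistent and positive definite. Then every $\mathcal H_0$-Suslin function $f\in\mathcal F^+$ is $c$-capacitable, that is, $c^*(f)=c_*(f)$.
   Context: $X$ is a nonempty locally compact Hausdorff space, $\mathcal M^+$ the set of positive Radon measures on $X$ with the vague topology (coarsest topology making $\mu\mapsto\int\varphi\,d\mu$ continuous for every continuous compactly supported $\varphi$). $G:X\times X\to[0,+\infty]$ is a kernel: lower semicontinuous (l.s.c.), symmetric, and $G(x,x)>0$ for all $x$. For $\mu\in\mathcal M^+$: $G\mu(x)=\int G(x,y)\,d\mu(y)$, $\|\mu\|=(\int G\mu\,d\mu)^{1/2}$; $\mathcal E^+=\{\mu\in\mathcal M^+:\|\mu\|<+\infty\}$, $\mathcal E^+_1=\{\mu\in\mathcal M^+:\|\mu\|\le1\}$. $\mathcal F^+$: all functions $X\to[0,+\infty]$. $\mathcal G$: l.s.c. functions in $\mathcal F^+$. $\mathcal H_0$: finite-valued upper semicontinuous functions $X\to[0,+\infty[$ of compact support. $\mathcal C_0^+=\mathcal G\cap\mathcal H_0$. Energy capacity: $c(\varphi)=\max\{\int\varphi\,d\mu:\mu\in\mathcal E_1^+\}$ for $\varphi\in\mathcal C_0^+$; $c(h)=\inf\{c(\varphi):\varphi\in\mathcal C_0^+,\varphi\ge h\}$ for $h\in\mathcal H_0$; $c(g)=\sup\{c(\varphi):\varphi\in\mathcal C_0^+,\varphi\le g\}$ for $g\in\mathcal G$. For $f\in\mathcal F^+$: $c_*(f)=\sup\{c(h):h\in\mathcal H_0,h\le f\}$, $c^*(f)=\inf\{c(g):g\in\mathcal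 G,g\ge f\}$. $G$ is consistent if for every $\lambda\in\mathcal E^+$ the function $\mu\mapsto\int G\lambda\,d\mu$ on $\mathcal E^+_1$ is finite and vaguely continuous. $G$ is positive definite if $\int G\mu\,d\nu\le\|\mu\|\,\|\nu\|$ for all $\mu,\nu\in\mathcal E^+$. $f\in\mathcal F^+$ is an $\mathcal H_0$-Suslin function if it is obtained from $\mathcal H_0$ by the Suslin operation: there are $h_{s}\in\mathcal H_0$, indexed by the finite sequences $s=(s_1,\dots,s_n)$ of natural numbers ($n\ge1$), such that $f=\sup_{\sigma\in\mathbb N^{\mathbb N}}\inf_{n\ge1}h_{(\sigma_1,\dots,\sigma_n)}$ pointwise. *)

(* Defs.v *)
From HB Require Import structures.
From mathcomp Require Import all_boot all_order all_algebra.
From mathcomp Require Import all_classical all_reals all_analysis.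

Set Implicit Arguments.
Unset Strict Implicit.
Unset Printing Implicit Defensive.

Import Order.TTheory GRing.Theory Num.Theory.
Import numFieldNormedType.Exports.

Local Open Scope classical_set_scope.
Local Open Scope ring_scope.
Local Open Scope ereal_scope.

(* The library puts a measurable structure on a generated sigma-algebra only
   over a pointed type; nonempty spaces are hence [ptopologicalType]s. *)
Notation borel X := (g_sigma_algebraType (@open X)).

Section radon.
Context (R : realType) (X : ptopologicalType).

(* The standard regularity convention (outer regular on Borel sets, inner
   regular on open sets) that puts Radon measures on a locally compact Hausdorff
   space in bijection with the positive linear forms on its continuous
   compactly supported functions. *)
Definition is_radon (mu : {measure set (borel X) -> \bar R}) : Prop :=
  [/\ forall K : set X, compact K -> mu K < +oo,
      forall A : set (borel X), measurable A ->
        mu A = ereal_inf [set mu U | U in [set U : set X | open U /\ A `<=` U]]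
    & forall U : set X, open U ->
        mu U =
        ereal_sup [set mu K | K in [set K : set X | compact K /\ K `<=` U]]].

Record radon_measure := RadonMeasure {
  radon_val :> {measure set (borel X) -> \bar R} ;
  radon_valP : is_radon radon_val }.

HB.instance Definition _ := gen_eqMixin radon_measure.
HB.instance Definition _ := gen_choiceMixin radon_measure.

Definition test_function :=
  {phi : X -> R | continuous phi /\ compact (closure [set x | phi x != 0%R])}.

Definition vague : topologicalType :=
  sup_topology (fun phi : test_function =>
    Topological.class (initial_topology
      (fun mu : radon_measure => (\int[mu]_x (sval phi x))%R))).

End radon.

Section energy.
Context (R : realType) (X : ptopologicalType).
Implicit Types (G : X * X -> \bar R) (mu nu lam : radon_measure R X).

Definition is_kernel G : Prop :=
  [/\ forall z, 0 <= G z, lower_semicontinuous G,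
      forall x y, G (x, y) = G (y, x) & forall x, 0 < G (x, x)].

Definition potential G mu (x : X) : \bar R := \int[mu]_y G (x, y).

Definition energy_norm G mu : \bar R := sqrte (\int[mu]_x potential G mu x).

Definition finite_energy G : set (radon_measure R X) :=
  [set mu | energy_norm G mu < +oo].

Definition energy_ball G : set (radon_measure R X) :=
  [set mu | energy_norm G mu <= 1].

Definition consistent G : Prop := forall lam, finite_energy G lam ->
  (forall mu, energy_ball G mu -> \int[mu]_x potential G lam x \is a fin_num) /\
  {within (energy_ball G : set (vague R X)), continuous
    (fun mu : vague R X => \int[(mu : radon_measure R X)]_x potential G lam x)}.

Definition positive_definite G : Prop :=
  forall mu nu, finite_energy G mu -> finite_energy G nu ->
    \int[nu]_x potential G mu x <= energy_norm G mu * energy_norm G nu.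

End energy.

Section capacity.
Context (R : realType) (X : ptopologicalType).
Implicit Types (G : X * X -> \bar R) (f g h phi : X -> \bar R).

Definition upper_semicontinuous f : Prop := forall x a, f x < a%:E ->
  exists2 V, nbhs x V & forall y, V y -> f y < a%:E.

Definition Fplus : set (X -> \bar R) := [set f | forall x, 0 <= f x].

Definition lscplus : set (X -> \bar R) :=
  [set g | Fplus g /\ lower_semicontinuous g].

Definition H0 : set (X -> \bar R) :=
  [set h | [/\ forall x, 0 <= h x < +oo, upper_semicontinuous h
             & compact (closure [set x | h x != 0])]].

Definition C0plus : set (X -> \bar R) := lscplus `&` H0.

Definition fle f g : Prop := forall x, f x <= g x.

(* The supremum is attained, by vague compactness of the energy ball. *)
Definition cap_C0 G phi : \bar R :=
  ereal_sup [set \int[mu]_x phi x | mu in energy_ball G].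

Definition cap_H0 G h : \bar R :=
  ereal_inf [set cap_C0 G phi | phi in [set phi | C0plus phi /\ fle h phi]].

Definition cap_lsc G g : \bar R :=
  ereal_sup [set cap_C0 G phi | phi in [set phi | C0plus phi /\ fle phi g]].

Definition lower_cap G f : \bar R :=
  ereal_sup [set cap_H0 G h | h in [set h | H0 h /\ fle h f]].

Definition upper_cap G f : \bar R :=
  ereal_inf [set cap_lsc G g | g in [set g | lscplus g /\ fle f g]].

(* A scheme is a family over all finite sequences, but its value at the empty
   sequence is neither constrained nor used. *)
Definition H0_Suslin f : Prop :=
  exists h : seq nat -> X -> \bar R,
    (forall s, s != [::] -> H0 (h s)) /\
    forall x, f x = ereal_sup [set
      ereal_inf [set h (mkseq sigma n) x | n in [set n | (1 <= n)%N]]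
        | sigma in [set: nat -> nat]].

End capacity.

(* Main.v *)
Require Import Defs.
From HB Require Import structures.
From mathcomp Require Import all_boot all_order all_algebra.
From mathcomp Require Import all_classical all_reals all_analysis.
From mathcomp Require Import measurable_realfun ring lra.

Set Implicit Arguments.
Unset Strict Implicit.
Unset Printing Implicit Defensive.

Import Order.TTheory GRing.Theory Num.Theory.
Import numFieldNormedType.Exports.

Local Open Scope classical_set_scope.
Local Open Scope ring_scope.

(** The theorem is an instance of Choquet's capacitability theorem, whose two
    hypotheses have to be checked for the upper capacity: it passes to the limit
    along increasing sequences of arbitrary functions ([upper_cap_sup]), and
    along decreasing sequences in [H0]. The latter is a consequence of
    compactness, used here in a form adapted to Suslin schemes: if the upper
    capacity of [f] exceeds [t], then continuity along increasing sequences
    gives bounds [beta n] on the indices such that all the truncated schemes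
    have upper capacity above [t] ([exists_box]); the supremum over the compact
    set of all branches within these bounds is a function of [H0] below [f]
    ([suslin_box_H0]), and any test function above it nearly dominates some
    truncated scheme ([suslin_box_approx]).

    The heart of the matter is continuity along increasing sequences. The energy
    ball, that is the set of measures of energy norm at most 1, is vaguely
    compact ([energy_ball_compact]). Consistency then has two effects. First, a
    variational argument ([exists_equilibrium]) and a compactness argument
    ([exists_dominating]) show that a lower semicontinuous [g] of capacity at
    most [s] is dominated by [s] times the potential of some measure of the
    ball, in the mean for every measure of the ball. Second, by Dini's theorem a
    potential is approximated by a test function below it, uniformly in the mean
    over the ball ([exists_minorant]). Together: if the upper capacity of [f] is
    less than [s], then [f <= s * psi + u] with a test function [psi] below a
    potential and a lower semicontinuous [u] of small capacity
    ([upper_cap_split]). Given an increasing sequence [f n] of upper capacities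
    less than [s], and such [psi n], [u n], let [lam] be a cluster point of the
    measures involved. The minimum of finitely many [psi n] with [n >= k],
    multiplied by [s], majorizes [f k] up to the sum of the [u n]; by
    consistency such a minimum can be chosen to be nearly at most the potential
    of [lam] in the mean, and once more this implies that it exceeds that
    potential by a function of small capacity only. So the limit of the
    sequence lies below [s] times the potential of [lam], up to functions of
    small capacity. By positive definiteness the capacity of the potential is at
    most 1, and the upper capacity of the limit is at most [s].

    Compactness of the energy ball and the modification of measures rest on the
    Riesz representation theorem ([riesz_integral]); the energies are handled
    through their approximation by finite sums of products of test functions
    ([energy_tensor]). *)

(** * Compactness and compactly supported functions *)

(** Extraction of finite subcovers, Dini's theorem and the tube lemma are all
    instances of the following principle, in which the index [i] is a bound, a
    neighbourhood, a test function, ... that can be improved at will. *)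
Lemma compact_directed (T : topologicalType) (K : set T) (I : Type)
    (P : I -> set T) :
  compact K -> inhabited I ->
  (forall i j, exists k, P i `<=` P k /\ P j `<=` P k) ->
  (forall x, K x -> exists i, \forall y \near x, K y -> P i y) ->
  exists i, K `<=` P i.
Proof.
move=> cK [i0] dir loc.
pose F : set_system I := [set A | exists i, forall j, P i `<=` P j -> A j].
have FF : Filter F.
  split; first by exists i0.
    move=> A B [i Ai] [j Bj]; have [k [ik jk]] := dir i j.
    by exists k => l kl; split; [exact/Ai/(subset_trans ik)|
                                 exact/Bj/(subset_trans jk)].
  by move=> A B AB [i Ai]; exists i => j /Ai; exact: AB.
have [|i +] := (near_covering_withinP K).2
    ((compact_near_coveringP K).1 cK) I F P FF.
  move=> x Kx; have [i iP] := loc x Kx.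
  exists ([set y | K y -> P i y], [set j | P i `<=` P j]) => /=.
    by split => //; exists i.
  by move=> [y j] /= [yP ij] Ky; exact/ij/yP.
by move=> /(_ i (@subset_refl _ _)); exists i.
Qed.

Section ctest.
Context (R : realType) (X : topologicalType).
Implicit Types (p q : X -> R) (K L U : set X).

(** Test functions are taken nonnegative: their integrals can then be computed
    in the extended reals without any integrability condition. *)
Definition ctest p := [/\ continuous p, forall x, 0 <= p x
  & exists2 K, compact K & forall x, ~ K x -> p x = 0].

Lemma ctest_ge0 p x : ctest p -> 0 <= p x. Proof. by case. Qed.

Lemma ctest_dom p q : ctest p -> continuous q -> (forall x, 0 <= q x) ->
  (forall x, p x = 0 -> q x = 0) -> ctest q.
Proof.
move=> [_ _ [K cK pK]] cq q0 pq; split => //; exists K => // x /pK; exact: pq.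
Qed.

Lemma ctest0 : ctest (fun=> 0).
Proof.
by split => //; [move=> x; exact: cvg_cst|exists set0 => //; exact: compact0].
Qed.

Lemma ctestD p q : ctest p -> ctest q -> ctest (fun x => p x + q x).
Proof.
move=> [cp p0 [K cK pK]] [cq q0 [L cL qL]]; split.
- by move=> x; apply: cvgD; [exact: cp|exact: cq].
- by move=> x; rewrite addr_ge0.
- exists (K `|` L); first exact: compactU.
  by move=> x /not_orP[/pK -> /qL ->]; rewrite addr0.
Qed.

Lemma ctestM p q : ctest p -> continuous q -> (forall x, 0 <= q x) ->
  ctest (fun x => q x * p x).
Proof.
move=> tp cq q0; have [cp p0 _] := tp; apply: (ctest_dom tp).
- by move=> x; apply: cvgM; [exact: cq|exact: cp].
- by move=> x; rewrite mulr_ge0.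
- by move=> x ->; rewrite mulr0.
Qed.

Lemma ctestZ p (a : R) : 0 <= a -> ctest p -> ctest (fun x => a * p x).
Proof. by move=> a0 tp; apply: ctestM => // x; exact: cvg_cst. Qed.

Lemma continuous_maxr p q : continuous p -> continuous q ->
  continuous (fun x => Num.max (p x) (q x)).
Proof. by move=> cp cq x; exact: (continuous_max (cp x) (cq x)). Qed.

Lemma continuous_minr p q : continuous p -> continuous q ->
  continuous (fun x => Num.min (p x) (q x)).
Proof. by move=> cp cq x; exact: (continuous_min (cp x) (cq x)). Qed.

Lemma ctest_max p q : ctest p -> ctest q ->
  ctest (fun x => Num.max (p x) (q x)).
Proof.
move=> tp tq; apply: (ctest_dom (ctestD tp tq)).
- by apply: continuous_maxr; [case: tp|case: tq].
- by move=> x; rewrite le_max (ctest_ge0 _ tp).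
- move=> x /eqP; rewrite paddr_eq0 ?(ctest_ge0 _ tp) ?(ctest_ge0 _ tq)//.
  by move=> /andP[/eqP -> /eqP ->]; rewrite maxxx.
Qed.

Lemma ctest_min p q : ctest p -> continuous q -> (forall x, 0 <= q x) ->
  ctest (fun x => Num.min (p x) (q x)).
Proof.
move=> tp cq q0; apply: (ctest_dom tp).
- by apply: continuous_minr => //; case: tp.
- by move=> x; rewrite le_min (ctest_ge0 _ tp) q0.
- by move=> x ->; apply/min_idPl.
Qed.

Lemma ctest_posB p q : ctest p -> continuous q -> (forall x, 0 <= q x) ->
  ctest (fun x => Num.max (p x - q x) 0).
Proof.
move=> tp cq q0; have [cp p0 _] := tp; apply: (ctest_dom tp).
- apply: continuous_maxr => x; last exact: cvg_cst.
  by apply: cvgB; [exact: cp|exact: cq].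
- by move=> x; rewrite le_max lexx orbT.
- by move=> x ->; rewrite sub0r; apply/max_idPr; rewrite oppr_le0.
Qed.

Lemma ctest_posBc p (a : R) : 0 <= a -> ctest p ->
  ctest (fun x => Num.max (p x - a) 0).
Proof. by move=> a0 tp; apply: ctest_posB => // x; exact: cvg_cst. Qed.

Lemma ctest_bounded p : ctest p -> exists2 M, 0 < M & forall x, p x <= M.
Proof.
move=> [cp p0 [K cK pK]].
have [|i j||M pM] := @compact_directed _ K R (fun M => [set x | p x <= M]) cK.
- exact: (inhabits 0).
- exists (Num.max i j); split=> x /= px; rewrite le_max px ?orbT//.
- move=> x _; exists (p x + 1).
  have := cp x; move/cvgrPdist_lt => /(_ 1 ltr01); apply: filterS => y pxy _ /=.
  by move: pxy; rewrite ltr_norml; lra.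
exists (Num.max M 1); first by rewrite lt_max ltr01 orbT.
move=> x; rewrite le_max; have [/pM ->//|/pK ->] := pselect (K x).
by rewrite ler01 orbT.
Qed.

End ctest.

Section urysohn.
Context (R : realType) (X : topologicalType).
Hypothesis X_lc : locally_compact [set: X].
Hypothesis X_hausdorff : hausdorff_space X.
Implicit Types (p q : X -> R) (K L U : set X).

(** The relation usually written [p < U] in proofs of Riesz's theorem. *)
Definition below U p := [/\ ctest p, forall x, p x <= 1
  & exists L, [/\ compact L, L `<=` U & forall x, ~ L x -> p x = 0]].

Lemma belowT p U V : U `<=` V -> below U p -> below V p.
Proof.
move=> UV [tp p1 [L [cL LU pL]]]; split => //; exists L; split => //.
exact: subset_trans UV.
Qed.

Lemma below0 U : below U (fun=> 0).
Proof.
split => //; first exact: ctest0.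
by exists set0; split => //; exact: compact0.
Qed.

Lemma below_max p q U : below U p -> below U q ->
  below U (fun x => Num.max (p x) (q x)).
Proof.
move=> [tp p1 [K [cK KU pK]]] [tq q1 [L [cL LU qL]]]; split.
- exact: ctest_max.
- by move=> x; rewrite ge_max p1 q1.
- exists (K `|` L); split; first exact: compactU.
    by move=> x [/KU|/LU].
  by move=> x /not_orP[/pK -> /qL ->]; rewrite maxxx.
Qed.

Lemma bump_point U x : open U -> U x ->
  exists2 p, below U p & \forall y \near x, p y = 1.
Proof.
move=> oU Ux.
have [N nN [cN clN]] := X_lc (I : [set: X] x).
have {}nN : nbhs x N by have := nN; rewrite withinET.
pose B := ~` (U `&` N°).
have clB : closed B by apply: open_closedC; apply: openI => //;
  exact: open_interior.
have nBx : ~ B x by apply; split => //;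
  exact: nbhs_singleton (nbhs_interior nN).
have usep := @locally_compact_completely_regular X R X_lc X_hausdorff x B clB nBx.
have /uniform_separatorP := usep => /(_ R)[f [cf f01 fx fB]].
have fx0 : f x = 0 by apply: fx; exists x.
pose p y := Num.min 1 (Num.max (2 - 4 * f y) 0).
have cp : continuous p.
  apply: continuous_minr; first by move=> ?; exact: cvg_cst.
  apply: continuous_maxr => [y|y]; last exact: cvg_cst.
  apply: cvgB; first exact: cvg_cst.
  by apply: cvgM; [exact: cvg_cst|exact: cf].
pose L := [set y | f y <= 1 / 2].
have LUN : L `<=` U `&` N°.
  move=> y; rewrite /L /= => fy; apply: contrapT => nB.
  by have := fB (f y) (imageP f (nB : B y)) => /=; lra.
have cL : compact L.
  apply: (subclosed_compact _ cN); last by move=> y /LUN[_ /interior_subset].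
  exact: (closed_comp (fun y _ => cf y) (@closed_le R (1 / 2))).
have pL y : ~ L y -> p y = 0.
  rewrite /L /= => /negP; rewrite -ltNge => fy.
  rewrite /p; have /max_idPr -> : 2 - 4 * f y <= 0 by lra.
  by apply/min_idPr.
exists p.
  split; first split => //.
  - by move=> y; rewrite /p le_min ler01 le_max lexx orbT.
  - by exists L.
  - by move=> y; rewrite /p ge_min lexx.
  - by exists L; split => //; move=> y /LUN[].
have q4 : 0 < 1 / 4 :> R by lra.
have /cvgrPdist_lt/(_ _ q4) := cf x; rewrite fx0; apply: filterS => y.
rewrite sub0r normrN ltr_norml => fy; rewrite /p.
by apply/min_idPl; rewrite le_max; apply/orP; left; lra.
Qed.

Lemma bump_compact K U : compact K -> open U -> K `<=` U ->
  exists p, below U p /\ forall x, K x -> \forall y \near x, p y = 1.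
Proof.
move=> cK oU KU; pose I := {p | below U p}.
have [|p q||p pK] := @compact_directed _ K I
    (fun (p : I) => [set x | \forall y \near x, sval p y = 1]) cK.
- exact: (inhabits (exist _ _ (below0 U))).
- exists (exist _ _ (below_max (svalP p) (svalP q))); split=> x /=;
    apply: filterS => y ->.
    by apply/max_idPl; have [_ + _] := svalP q; exact.
  by apply/max_idPr; have [_ + _] := svalP p; exact.
- move=> x Kx; have [p bp p1] := bump_point oU (KU _ Kx).
  by exists (exist _ p bp) => /=; move/nbhs_interior: p1; apply: filterS.
by exists (sval p); split; [exact: svalP|exact: pK].
Qed.

Lemma bump_on K : compact K ->
  exists2 p : X -> R, ctest p & (forall x, p x <= 1) /\ forall x, K x ->
    p x = 1.
Proof.
move=> cK; have [p [[tp p1 _] pK]] := bump_compact cK openT (@subsetT _ _).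
by exists p => //; split => // x /pK /nbhs_singleton.
Qed.

End urysohn.

(** * Staircases *)

Section staircase.
Context (R : realType).
Implicit Types (t d : R) (k N : nat).

(** The part of [t] between the heights [k * d] and [k.+1 * d]. *)
Definition stair d k t : R := Num.min (Num.max (t - k%:R * d) 0) d.

Lemma stair_ge0 d k t : 0 <= d -> 0 <= stair d k t.
Proof. by move=> d0; rewrite /stair le_min le_max lexx orbT. Qed.

Lemma stair_le d k t : stair d k t <= d.
Proof. by rewrite /stair ge_min lexx orbT. Qed.

Lemma stair_off d k t : 0 <= d -> t <= k%:R * d -> stair d k t = 0.
Proof.
move=> d0 td; rewrite /stair; have /max_idPr -> : t - k%:R * d <= 0 by lra.
exact/min_idPl.
Qed.

Lemma stair_on d k t : k.+1%:R * d < t -> stair d k t = d.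
Proof.
rewrite -natr1 mulrDl mul1r => dt; apply/min_idPr.
by rewrite le_max; apply/orP; left; lra.
Qed.

Lemma stair_sum d N t : 0 <= d -> 0 <= t ->
  \sum_(k < N) stair d k t = Num.min t (N%:R * d).
Proof.
move=> d0 t0; elim: N => [|N IH].
  by rewrite big_ord0 mul0r; apply/esym/min_idPr.
rewrite big_ord_recr/= IH /stair -natr1 mulrDl mul1r.
by rewrite /Num.min /Num.max; do ! case: ifPn; rewrite -?leNgt; lra.
Qed.

Lemma stair_sum_le d N t : 0 <= d -> 0 <= t -> \sum_(k < N) stair d k t <= t.
Proof. by move=> d0 t0; rewrite stair_sum// ge_min lexx. Qed.

End staircase.

Local Open Scope ereal_scope.

Section ereal_aux.
Context (R : realType).
Implicit Types (S : set \bar R).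

Lemma ereal_sup_addr_le S (m b : \bar R) : S !=set0 ->
  (forall x, S x -> 0 <= x) ->
  0 <= m -> (forall x, S x -> x + m <= b) -> ereal_sup S + m <= b.
Proof.
move=> [x0 Sx0] S0 m0 Sb; case: m m0 Sb => [m| |]// m0 Sb.
- rewrite -leeBrDr//; apply: ge_ereal_sup => x Sx.
  by rewrite leeBrDr//; exact: Sb.
- have := Sb _ Sx0; rewrite addey;
    last by rewrite gt_eqF// (lt_le_trans _ (S0 _ Sx0))// ltNyr.
  by rewrite leye_eq => /eqP ->; rewrite leey.
Qed.

Lemma lee_real (x y : \bar R) :
  (forall a : R, a%:E < x -> a%:E <= y) -> x <= y.
Proof.
case: x y => [r| |] [s| |] H //; rewrite ?leey ?leNye//.
- rewrite leNgt; apply/negP; rewrite lte_fin => sr.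
  by have := H ((s + r) / 2)%R; rewrite !lte_fin lee_fin; lra.
- by have := H (r - 1)%R; rewrite lte_fin gtrBl ltr01 => /(_ isT).
- by have := H (s + 1)%R; rewrite ltry lee_fin => /(_ isT); rewrite gerDl ler10.
- by have := H 0%R; rewrite ltry => /(_ isT).
Qed.

End ereal_aux.

(** * Borel measurability *)

Section borel.
Context (R : realType) (X : ptopologicalType).

Lemma open_borel (U : set X) : open U -> measurable (U : set (borel X)).
Proof. by move=> oU; exact: sub_sigma_algebra. Qed.

Lemma compact_borel (K : set X) : hausdorff_space X -> compact K ->
  measurable (K : set (borel X)).
Proof.
move=> hX cK; rewrite -[K]setCK; apply: measurableC; apply: open_borel.
by apply: closed_openC; exact: compact_closed.
Qed.

Lemma lsc_borel (g : X -> \bar R) : lower_semicontinuous g ->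
  measurable_fun [set: borel X] g.
Proof.
move=> scg; apply: (measurability _ (ErealGenOInfty.measurableE R)).
move=> /= _ [_ [a ->]] <-; rewrite setTI; apply: open_borel.
by rewrite preimage_itvoy; move/lower_semicontinuousP : scg; exact.
Qed.

Lemma continuous_lsc (p : X -> R) : continuous p ->
  lower_semicontinuous (EFin \o p).
Proof.
move=> cp; apply/lower_semicontinuousP => a.
rewrite (_ : [set _ | _] = p @^-1` [set y | a < y]%R); last first.
  by apply/seteqP; split=> x /=; rewrite lte_fin.
by apply: open_comp; [move=> x _; exact: cp|exact: open_gt].
Qed.

Lemma continuous_borel (p : X -> R) : continuous p ->
  measurable_fun [set: borel X] (EFin \o p).
Proof. by move=> cp; apply: lsc_borel; exact: continuous_lsc. Qed.

Lemma ctest_borel (p : X -> R) : ctest p ->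
  measurable_fun [set: borel X] (fun x => (p x)%:E).
Proof. by case=> cp _ _; exact: continuous_borel. Qed.

Lemma indicZ_borel (a : R) (A : set (borel X)) : measurable A ->
  measurable_fun [set: borel X] (fun x => (a * \1_A x)%:E).
Proof.
by move=> mA; apply/measurable_EFinP/measurable_funM.
Qed.

End borel.
#[global] Hint Resolve ctest_borel lsc_borel : core.

(** * Integration against a Radon measure *)

Section radon_integral.
Context (R : realType) (X : ptopologicalType).
Hypothesis X_lc : locally_compact [set: X].
Hypothesis X_hausdorff : hausdorff_space X.
Implicit Types (p q : X -> R) (g : X -> \bar R) (K U : set X).
Implicit Types (mu : radon_measure R X).

Lemma ctest_integral_ge0 mu p : ctest p -> 0 <= \int[mu]_x (p x)%:E.
Proof. by move=> [_ p0 _]; apply: integral_ge0 => x _; rewrite lee_fin. Qed.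

Lemma ctest_integral_fin mu p : ctest p -> \int[mu]_x (p x)%:E \is a fin_num.
Proof.
move=> tp; rewrite ge0_fin_numE; last exact: ctest_integral_ge0.
have [M M0 pM] := ctest_bounded tp; have [cp p0 [K cK pK]] := tp.
have mK := compact_borel X_hausdorff cK.
apply: (@le_lt_trans _ _ (\int[mu]_x (M * \1_K x)%:E)).
  apply: ge0_le_integral => //.
  - by move=> x _; rewrite lee_fin.
  - exact: ctest_borel.
  - by apply/measurable_EFinP/measurable_funM => //; exact: measurable_indic.
  move=> x _; rewrite lee_fin indicE; case: (boolP (x \in _)) => [_|].
    by rewrite /= mulr1.
  by rewrite notin_setE => /pK ->; rewrite /= mulr0.
under eq_integral do rewrite EFinM.
rewrite ge0_integralZl//; last 2 first.
- by apply/measurable_EFinP; exact: measurable_indic.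
- by rewrite lee_fin ltW.
rewrite integral_indic// setIT lte_mul_pinfty// ?lee_fin ?ltW//.
by have [+ _ _] := radon_valP mu; exact.
Qed.

Lemma ctest_integralD mu p q : ctest p -> ctest q ->
  \int[mu]_x (p x + q x)%:E = \int[mu]_x (p x)%:E + \int[mu]_x (q x)%:E.
Proof.
move=> tp tq; under eq_integral do rewrite EFinD.
by rewrite ge0_integralD//; try (move=> x _; rewrite lee_fin ctest_ge0//);
  exact: ctest_borel.
Qed.

Lemma ctest_integralZ mu (a : R) p : (0 <= a)%R -> ctest p ->
  \int[mu]_x (a * p x)%:E = a%:E * \int[mu]_x (p x)%:E.
Proof.
move=> a0 tp; under eq_integral do rewrite EFinM.
rewrite ge0_integralZl//; first exact: ctest_borel.
by move=> x _; rewrite lee_fin ctest_ge0.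
Qed.

Lemma ctest_integral_le mu p g : ctest p -> lower_semicontinuous g ->
  (forall x, (p x)%:E <= g x) -> \int[mu]_x (p x)%:E <= \int[mu]_x g x.
Proof.
move=> tp lg pg; apply: ge0_le_integral => //.
- by move=> x _; rewrite lee_fin ctest_ge0.
- exact: ctest_borel.
- exact: lsc_borel.
Qed.

Lemma radon_open_sup mu U : open U ->
  mu U = ereal_sup [set \int[mu]_x (p x)%:E | p in below U].
Proof.
move=> oU; apply/eqP; rewrite eq_le; apply/andP; split.
  have -> : mu U = ereal_sup [set mu K | K in [set K | compact K /\ K `<=` U]].
    by have [_ _] := radon_valP mu; exact.
  apply: ge_ereal_sup => _ [K [cK KU] <-].
  have mK := compact_borel X_hausdorff cK.
  have [p [bp pK]] := @bump_compact R X X_lc X_hausdorff K U cK oU KU.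
  apply: le_ereal_sup_tmp; exists (\int[mu]_x (p x)%:E); first by exists p.
  have [tp _ _] := bp.
  rewrite -[in leLHS](setIT K) -integral_indic//.
  apply: ge0_le_integral => //.
  - by apply/measurable_EFinP; exact: measurable_indic.
  - exact: ctest_borel.
  - move=> x _; rewrite lee_fin indicE; case: (boolP (x \in _)) => [|_].
      by rewrite inE => /pK/nbhs_singleton ->.
    exact: ctest_ge0.
apply: ge_ereal_sup => _ [p [tp p1 [L [cL LU pL]]] <-].
have mU := open_borel oU.
rewrite -[leRHS]/(mu U) -[in leRHS](setIT U) -integral_indic//.
apply: ge0_le_integral => //.
- by move=> x _; rewrite lee_fin ctest_ge0.
- exact: ctest_borel.
- by apply/measurable_EFinP; exact: measurable_indic.
move=> x _; rewrite lee_fin indicE; case: (boolP (x \in _)) => [_|];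
  first exact: p1.
by rewrite notin_setE => nU; rewrite pL//= => /LU.
Qed.

(** A sum of open superlevel sets is exhausted by test functions: together the
    chosen functions stay under the graph of [g]. *)
Lemma lsc_stair_le mu g (d : R) (N : nat) (c : \bar R) : (0 < d)%R ->
  (forall x, 0 <= g x) -> lower_semicontinuous g ->
  (forall p, ctest p -> (forall x, (p x)%:E <= g x) -> \int[mu]_x (p x)%:E <= c) ->
  \sum_(k < N) d%:E * mu [set x | (k.+1%:R * d)%:E < g x] <= c.
Proof.
move=> d0 g0 lg gc.
have oV k : open [set x | (k.+1%:R * d)%:E < g x].
  exact: (lower_semicontinuousP _).1.
pose t x := fine (mine (g x) (N.+1%:R * d)%:E).
have tE x : (t x)%:E = mine (g x) (N.+1%:R * d)%:E.
  rewrite /t fineK// ge0_fin_numE; first by rewrite gt_min ltry orbT.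
  by rewrite le_min g0 lee_fin mulr_ge0// ltW.
have tg x : (t x)%:E <= g x by rewrite tE ge_min lexx.
have t0 x : (0 <= t x)%R.
  by rewrite -lee_fin tE le_min g0 lee_fin mulr_ge0// ltW.
have tV k x : (k < N)%N -> (k.+1%:R * d)%:E < g x -> (k.+1%:R * d < t x)%R.
  move=> kN gx; rewrite -lte_fin tE lt_min gx lte_fin ltr_pM2r// ltr_nat.
  by rewrite ltnS.
suff H n q : (n <= N)%N -> ctest q ->
    (forall x, q x <= \sum_(n <= k < N) stair d k (t x))%R ->
    \sum_(k < n) d%:E * mu [set x | (k.+1%:R * d)%:E < g x] +
      \int[mu]_x (q x)%:E <= c.
  have := H N (fun=> 0%R) (leqnn _) (ctest0 _ _).
  rewrite integral0 adde0; apply => // x.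
  by rewrite big_geq.
elim: n q => [|n IH] q nN tq qt.
  rewrite big_ord0 add0e; apply: gc => // x; apply: le_trans (tg x).
  by rewrite lee_fin (le_trans (qt x))// big_mkord stair_sum_le// ltW.
have oVn := oV n.
rewrite big_ord_recr/= radon_open_sup// -ereal_supZl ?(ltW d0)//; last first.
  by apply/set0P; exists (\int[mu]_x (cst 0%R x)%:E); exists (cst 0%R) => //;
     exact: below0.
rewrite addeAC addeC.
apply: ereal_sup_addr_le.
- exists (d%:E * \int[mu]_x (cst 0%R x)%:E).
  exists (\int[mu]_x (cst 0%R x)%:E) => //; exists (cst 0%R) => //.
  exact: below0.
- move=> _ [_ [p [tp _ _] <-] <-]; rewrite mule_ge0 ?lee_fin ?(ltW d0)//.
  exact: ctest_integral_ge0.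
- rewrite adde_ge0// ?ctest_integral_ge0// sume_ge0// => k _.
  by rewrite mule_ge0// lee_fin ltW.
move=> _ [_ [p [tp p1 [L [cL LV pL]]] <-] <-].
rewrite -ctest_integralZ ?(ltW d0)// addeCA -ctest_integralD//; last first.
  exact: (ctestZ (ltW d0)).
apply: IH; first exact: ltnW.
  by apply: ctestD => //; exact: (ctestZ (ltW d0)).
move=> x; rewrite big_ltn// lerD//.
have [Lx|/pL ->] := pselect (L x); last by rewrite mulr0 stair_ge0// ltW.
have {}Lx : (n.+1%:R * d < t x)%R by apply: tV => //; exact: LV.
by rewrite stair_on// ger_pMr.
Qed.

(** Lower semicontinuous functions are, as far as Radon measures can tell,
    suprema of test functions. For test functions below [g] bounded in integral
    by [c], the staircase sums over the superlevel sets of [g] are bounded by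
    [c] too, and these sums tend to [g] as the steps get finer. *)
Lemma lsc_integral_le mu g c :
  (forall x, 0 <= g x) -> lower_semicontinuous g ->
  (forall p, ctest p -> (forall x, (p x)%:E <= g x) -> \int[mu]_x (p x)%:E <= c) ->
  \int[mu]_x g x <= c.
Proof.
move=> g0 lg gc.
pose d n : R := (n.+1%:R^-1)%R.
have d0 n : (0 < d n)%R by rewrite invr_gt0.
pose V n k := [set x : borel X | (k.+1%:R * d n)%:E < g x].
have mV n k : measurable (V n k).
  by apply: open_borel; exact: (lower_semicontinuousP _).1.
pose s n (x : borel X) := \sum_(k < (n * n)%N) (d n * \1_(V n k) x)%:E.
have ms n : measurable_fun setT (s n).
  by apply: emeasurable_sum => k; exact: indicZ_borel.
have s0 n x : 0 <= s n x.
  by apply: sume_ge0 => k _; rewrite lee_fin mulr_ge0// ltW.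
have ints n : \int[mu]_x s n x <= c.
  rewrite ge0_integral_sum//; last 2 first.
  - by move=> k; exact: indicZ_borel.
  - by move=> k x _; rewrite lee_fin mulr_ge0// ltW.
  apply: le_trans (@lsc_stair_le mu g (d n) (n * n)%N c (d0 n) g0 lg gc).
  apply: lee_sum => k _.
  under eq_integral do rewrite EFinM.
  rewrite ge0_integralZl//; last 2 first.
  - by apply/measurable_EFinP; exact: measurable_indic.
  - by rewrite lee_fin ltW.
  by rewrite integral_indic// setIT.
have supE (u : (\bar R)^nat) : limn_einf u = ereal_sup (range (einfs u)).
  by rewrite limn_einf_lim; apply/cvg_lim => //; exact: cvg_einfs_sup.
apply: (@le_trans _ _ (\int[mu]_x limn_einf (s^~ x))); last first.
  apply: le_trans (fatou _ _ _ _) _ => //.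
  rewrite supE; apply: ge_ereal_sup => _ [n _ <-].
  by apply: le_trans (ints n); apply: ereal_inf_lbound; exists n => /=.
apply: ge0_le_integral => //.
- exact: lsc_borel.
- apply: (emeasurable_fun_cvg (fun n x => einfs (s^~ x) n)).
    by move=> n; exact: measurable_fun_einfs.
  by move=> x _; rewrite supE; exact: cvg_einfs_sup.
move=> x _.
apply: lee_real => a ag; rewrite supE.
have [a0|a0] := ltP a 0%R.
  apply: le_ereal_sup_tmp; exists (einfs (s^~ x) 0%N); first by exists 0%N.
  apply: le_ereal_inf_tmp => _ [m _ <-].
  by apply: le_trans (s0 m x); rewrite lee_fin ltW.
have [t at_ tg] : exists2 t : R, (a < t)%R & t%:E <= g x.
  move: ag (g0 x); case: (g x) => [r| |]//; last first.
    by exists (a + 1)%R; rewrite ?ltrDl ?leey.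
  by rewrite lte_fin => ar _; exists r.
pose n := Num.bound (a + 1 + (t - a)^-1)%R.
have nP : (a + 1 + (t - a)^-1 < n%:R)%R.
  by apply: archi_boundP; rewrite !addr_ge0// invr_ge0 subr_ge0 ltW.
apply: le_ereal_sup_tmp; exists (einfs (s^~ x) n); first by exists n.
apply: le_ereal_inf_tmp => _ [m /= nm <-].
have {nP} mP : (a + 1 + (t - a)^-1 <= m%:R)%R.
  by apply: le_trans (ltW nP) _; rewrite ler_nat.
have t_a : (0 < (t - a)^-1)%R by rewrite invr_gt0 subr_gt0.
have dta : (d m <= t - a)%R.
  rewrite -[leRHS]invrK lef_pV2 ?posrE// -natr1.
  by apply: le_trans (_ : m%:R <= _)%R; [lra|rewrite lerDl].
have mda : (a + d m <= (m * m).+1%:R * d m)%R.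
  rewrite -natr1 mulrDl mul1r lerD2r natrM /d ler_pdivlMr// -natr1.
  nra.
have : (a + d m <= \sum_(k < (m * m).+1) stair (d m) k t)%R.
  rewrite stair_sum ?(ltW (d0 m)) ?(le_trans a0 (ltW at_))// le_min mda andbT.
  by lra.
rewrite big_ord_recl/= => am.
have {}am : (a <= \sum_(k < m * m) stair (d m) k.+1 t)%R.
  have := stair_le (d m) 0 t; move: am; rewrite /bump/=.
  under eq_bigr do rewrite add1n.
  by move=> ? ?; lra.
rewrite -lee_fin in am; apply: le_trans am _; rewrite -sumEFin.
apply: lee_sum => k _; rewrite lee_fin indicE.
case: (boolP (x \in V m k)) => xV; first by rewrite /= mulr1 stair_le.
rewrite mulr0 stair_off ?(ltW (d0 m))//.
move: xV; rewrite notin_setE /V/= => /negP; rewrite -leNgt => gx.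
by rewrite -lee_fin (le_trans tg).
Qed.

End radon_integral.

(** * The Riesz representation theorem *)

Section riesz.
Context (R : realType) (X : ptopologicalType).
Hypothesis X_lc : locally_compact [set: X].
Hypothesis X_hausdorff : hausdorff_space X.
Implicit Types (p q : X -> R) (A E K U V : set X).
Variable L : (X -> R) -> R.
Hypothesis L_ge0 : forall p, ctest p -> (0 <= L p)%R.
Hypothesis LD : forall p q, ctest p -> ctest q ->
  L (fun x => p x + q x)%R = (L p + L q)%R.
Hypothesis LZ : forall (a : R) p, (0 <= a)%R -> ctest p ->
  L (fun x => a * p x)%R = (a * L p)%R.

Let L0 : L (fun=> 0%R) = 0%R.
Proof.
transitivity (0 * L (fun=> 0))%R; last by rewrite mul0r.
rewrite -(LZ (lexx 0%R) (@ctest0 R X)).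
by congr L; apply/funext => x; rewrite mul0r.
Qed.

Let le_L p q : ctest p -> ctest q -> (forall x, p x <= q x)%R -> (L p <= L q)%R.
Proof.
move=> tp tq pq; have tqp : ctest (fun x => q x - p x)%R.
  apply: (ctest_dom tq).
  - by move=> x; apply: cvgB; [case: tq => + _ _|case: tp => + _ _]; exact.
  - by move=> x; rewrite subr_ge0.
  - move=> x qx; apply/eqP; rewrite subr_eq0 qx eq_le (ctest_ge0 _ tp).
    by rewrite -qx pq.
have -> : q = (fun x => p x + (q x - p x))%R by apply/funext => x; lra.
by rewrite LD// lerDl L_ge0.
Qed.

Let L_sum n (p : nat -> X -> R) : (forall k, ctest (p k)) ->
  L (fun x => \sum_(k < n) p k x)%R = (\sum_(k < n) L (p k))%R
  /\ ctest (fun x => \sum_(k < n) p k x)%R.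
Proof.
move=> tp; elim: n => [|n [IH tn]].
  rewrite big_ord0; under [X in L X]funext do rewrite big_ord0.
  split => //; under [X in ctest X]funext do rewrite big_ord0.
  exact: ctest0.
under [X in L X]funext do rewrite big_ord_recr/=.
rewrite big_ord_recr/= LD// IH; split => //.
under [X in ctest X]funext do rewrite big_ord_recr/=.
exact: ctestD.
Qed.

(** The measure of open sets is read off the linear form, and extended to all
    sets from outside; the open sets turn out to be measurable in the sense of
    Caratheodory. *)
Definition riesz_open U : \bar R := ereal_sup [set (L p)%:E | p in below U].

Let rho := riesz_open.

Let rho_ge0 U : 0 <= rho U.
Proof.
by apply: ereal_sup_ubound; exists (fun=> 0%R); [exact: below0|rewrite L0].
Qed.

Let le_rho U V : U `<=` V -> rho U <= rho V.
Proof.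
by move=> UV; apply: ereal_sup_le => _ [p bp <-]; exists p => //;
  exact: belowT bp.
Qed.

Let rhoU U V : open U -> open V -> rho (U `|` V) <= rho U + rho V.
Proof.
move=> oU oV; apply: ge_ereal_sup => _ [p [tp p1 [K [cK KUV pK]]] <-].
have cKV : compact (K `\` V).
  by apply: compact_closedI => //; exact: open_closedC.
have KVU : K `\` V `<=` U by move=> x [/KUV[]].
have [q [bq q1]] := @bump_compact R X X_lc X_hausdorff _ _ cKV oU KVU.
have [tq q1' [K' [cK' K'U qK']]] := bq.
have [cp p0 _] := tp; have [cq q0 _] := tq.
have tqp : ctest (fun x => q x * p x)%R by exact: ctestM.
have trp : ctest (fun x => (1 - q x) * p x)%R.
  apply: ctestM => // x; last by rewrite subr_ge0.
  by apply: cvgB; [exact: cvg_cst|exact: cq].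
have -> : p = (fun x => q x * p x + (1 - q x) * p x)%R.
  by apply/funext => x; lra.
rewrite LD// EFinD; apply: leeD; apply: ereal_sup_ubound.
- exists (fun x => q x * p x)%R => //; split => //.
    by move=> x; rewrite mulr_ile1.
  by exists K'; split => // x /qK' ->; rewrite mul0r.
- exists (fun x => (1 - q x) * p x)%R => //; split => //.
    by move=> x; rewrite mulr_ile1// ?subr_ge0// gerBl.
  pose O := [set x | q x = 1%R]°.
  exists (K `\` O); split.
  + by apply: compact_closedI => //; apply: open_closedC; exact: open_interior.
  + by move=> x [Kx Ox]; apply: contrapT => Vx; apply: Ox; exact: q1.
  + move=> x /not_andP[/pK ->|/contrapT/interior_subset ->].
      by rewrite mulr0.
    by rewrite subrr mul0r.
Qed.

Let rho0 : rho set0 = 0.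
Proof.
apply/eqP; rewrite eq_le rho_ge0 andbT; apply: ge_ereal_sup => _ [p + <-].
move=> [_ _ [K [_ K0 pK]]]; rewrite (_ : p = fun=> 0%R) ?L0//.
by apply/funext => x; apply: pK => /K0.
Qed.

Let rho_bigcup (U : (set X)^nat) : (forall n, open (U n)) ->
  rho (\bigcup_n U n) <= \sum_(n <oo) rho (U n).
Proof.
move=> oU; apply: ge_ereal_sup => _ [p [tp p1 [K [cK KU pK]]] <-].
have [|m n|x /KU[n _ Ux]|n Kn] :=
    @compact_directed _ K nat (fun n => \big[setU/set0]_(k < n) U k) cK.
- exact: (inhabits 0%N).
- exists (maxn m n); split; apply: subset_bigsetU.
    exact: leq_maxl.
  exact: leq_maxr.
- exists n.+1; have : open_nbhs x (U n) by split.
  move=> /open_nbhs_nbhs; apply: filterS => y Uy _.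
  by rewrite big_ord_recr/=; right.
have rho_fin : rho (\big[setU/set0]_(k < n) U k) <= \sum_(k < n) rho (U k)
    /\ open (\big[setU/set0]_(k < n) U k).
  elim: {Kn} n => [|n [IH on]].
    by rewrite !big_ord0 rho0; split => //; exact: open0.
  rewrite !big_ord_recr/=; split; last exact: openU.
  by apply: le_trans (rhoU on (oU n)) _; rewrite leeD2r.
apply: (@le_trans _ _ (rho (\big[setU/set0]_(k < n) U k))).
  by apply: ereal_sup_ubound; exists p => //; split => //; exists K.
apply: le_trans rho_fin.1 _.
by rewrite -(big_mkord xpredT (fun k => rho (U k))); exact: nneseries_lim_ge.
Qed.

Definition riesz_outer E : \bar R :=
  ereal_inf [set rho U | U in [set U | open U /\ E `<=` U]].

Let outer := riesz_outer.

Let outer_open U : open U -> outer U = rho U.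
Proof.
move=> oU; apply/eqP; rewrite eq_le; apply/andP; split.
  by apply: ereal_inf_lbound; exists U => //; split.
by apply: le_ereal_inf_tmp => _ [V [oV UV] <-]; exact: le_rho.
Qed.

Let le_outer : {homo outer : A B / A `<=` B >-> A <= B}.
Proof.
move=> A B AB; apply: ereal_inf_le_tmp => _ [U [oU BU] <-].
by exists U => //; split => //; exact: subset_trans AB BU.
Qed.

Let outer_ge0 E : 0 <= outer E.
Proof. by apply: le_ereal_inf_tmp => _ [U _ <-]. Qed.

Let outer_approx E (e : R) : (0 < e)%R ->
  exists U, [/\ open U, E `<=` U & rho U <= outer E + e%:E].
Proof.
move=> e0; have [fE|] := boolP (outer E \is a fin_num).
  have [_ [U [oU EU] <-] /ltW rU] := lb_ereal_inf_adherent e0 fE.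
  by exists U.
rewrite ge0_fin_numE// -leNgt leye_eq => /eqP ->.
by exists setT; split => //; [exact: openT|rewrite addye// leey].
Qed.

Let outer0 : outer set0 = 0.
Proof. by rewrite outer_open ?rho0//; exact: open0. Qed.

Let outer_sigma_subadditive : sigma_subadditive outer.
Proof.
move=> F; apply/lee_addgt0Pr => e e0.
have [U UP] := choice (fun n => outer_approx (F n)
  (divr_gt0 e0 (ltr0Sn R (2 ^ n.+1).-1))).
apply: le_trans (epsilon_trick _ _ (ltW e0)) => //.
apply: (@le_trans _ _ (rho (\bigcup_n U n))).
  apply: ereal_inf_lbound; exists (\bigcup_n U n) => //; split.
    by apply: bigcup_open => n _; have [] := UP n.
  by apply: subset_bigcup => n _; have [] := UP n.
apply: le_trans (rho_bigcup _) _; first by move=> n; have [] := UP n.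
apply: lee_nneseries => // n _; have [_ _] := UP n.
by rewrite prednK// expn_gt0.
Qed.

HB.instance Definition _ := isOuterMeasure.Build R X outer outer0 outer_ge0
  le_outer outer_sigma_subadditive.

Let outer_caratheodory V : open V -> outer.-caratheodory V.
Proof.
move=> oV; apply: le_caratheodory_measurable => E.
apply: le_ereal_inf_tmp => _ [U [oU EU] <-].
have oUV : open (U `&` V) by exact: openI.
apply: (@le_trans _ _ (rho (U `&` V) + outer (U `&` ~` V))).
  by rewrite -outer_open//; apply: leeD; apply: le_outer; exact: setSI.
apply: ereal_sup_addr_le => //.
- by exists (L (fun=> 0%R))%:E; exists (fun=> 0%R) => //; exact: below0.
- by move=> _ [p [tp _ _] <-]; rewrite lee_fin L_ge0.
move=> _ [p [tp p1 [K [cK KUV pK]]] <-].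
have oUK : open (U `&` ~` K).
  by apply: openI => //; apply: closed_openC; exact: compact_closed.
apply: (@le_trans _ _ ((L p)%:E + rho (U `&` ~` K))).
  rewrite leeD2l// -outer_open//; apply: le_outer => x [Ux Vx]; split => //.
  by move=> /KUV[].
rewrite addeC; apply: ereal_sup_addr_le => //.
- by exists (L (fun=> 0%R))%:E; exists (fun=> 0%R) => //; exact: below0.
- by move=> _ [q [tq _ _] <-]; rewrite lee_fin L_ge0.
- by rewrite lee_fin L_ge0.
move=> _ [q [tq q1 [K' [cK' KUK qK]]] <-]; rewrite -EFinD -LD//.
apply: ereal_sup_ubound; exists (fun x => q x + p x)%R => //; split.
- exact: ctestD.
- move=> x; have [/KUK[_ /pK ->]|/qK ->] := pselect (K' x).
    by rewrite addr0.
  by rewrite add0r.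
exists (K' `|` K); split; first exact: compactU.
  by move=> x [/KUK[]|/KUV[]].
by move=> x /not_orP[/qK -> /pK ->]; rewrite addr0.
Qed.

Let borel_caratheodory (A : set (borel X)) : measurable A ->
  outer.-caratheodory A.
Proof.
move: A; apply: smallest_sub; last exact: outer_caratheodory.
split.
- exact: caratheodory_measurable_set0.
- by move=> A cA; rewrite setTD; exact: caratheodory_measurable_setC.
- by move=> F cF; exact: caratheodory_measurable_bigcup.
Qed.

Definition riesz_val (A : set (borel X)) : \bar R := outer A.

Let riesz_sigma_additive : semi_sigma_additive riesz_val.
Proof.
move=> F mF tF mUF.
apply: (@caratheodory_measure_sigma_additive R X outer F _ tF) => //.
  by move=> n; apply: borel_caratheodory; exact: mF.
exact: borel_caratheodory.
Qed.

HB.instance Definition _ := isMeasure.Build _ (borel X) R riesz_val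
  outer0 outer_ge0 riesz_sigma_additive.

Let rho_fin p : ctest p -> rho [set x | (0 < p x)%R] < +oo.
Proof.
move=> [_ _ [K cK pK]].
have [q tq [q1 qK]] := @bump_on R X X_lc X_hausdorff _ cK.
apply: le_lt_trans (ltry (L q)); apply: ge_ereal_sup.
move=> _ [r [tr r1 [K' [cK' K'p rK]]] <-]; rewrite lee_fin; apply: le_L => // x.
have [/qK ->|Kx] := pselect (K x); first exact: r1.
rewrite rK ?(ctest_ge0 _ tq)// => /K'p/=.
by rewrite pK// ltxx.
Qed.

Let riesz_radon : is_radon riesz_val.
Proof.
split.
- move=> K cK; have [q tq [q1 qK]] := @bump_on R X X_lc X_hausdorff _ cK.
  apply: le_lt_trans (rho_fin tq); apply: ereal_inf_lbound.
  exists [set x | (0 < q x)%R] => //; split; last by move=> x /qK/= ->.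
  have [cq _ _] := tq.
  by apply: (@open_comp _ _ q [set y | (0 < y)%R]) => [x _|];
    [exact: cq|exact: open_gt].
- move=> A _; congr ereal_inf; apply/seteqP; split => [_ [U [oU AU] <-]|].
    by exists U => //=; rewrite /riesz_val outer_open.
  by move=> _ [U [oU AU] <-]; exists U => //=; rewrite /riesz_val outer_open.
- move=> U oU; apply/eqP; rewrite eq_le; apply/andP; split; last first.
    by apply: ge_ereal_sup => _ [K [cK KU] <-]; exact: le_outer.
  apply: (@le_trans _ _ (rho U)); first by rewrite -outer_open.
  apply: ge_ereal_sup.
  move=> _ [p [tp p1 [K [cK KU pK]]] <-]; apply: le_ereal_sup_tmp.
  exists (riesz_val K); first by exists K.
  apply: le_ereal_inf_tmp => _ [V [oV KV] <-].
  by apply: ereal_sup_ubound; exists p => //; split => //; exists K.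
Qed.

Definition riesz_measure : radon_measure R X := RadonMeasure riesz_radon.

Let integral_superlevel p (q : X -> R) (d a : R) : ctest q -> (0 <= d)%R ->
  continuous p ->
  (forall x, q x <= d)%R -> (forall x, p x <= a -> q x = 0)%R ->
  \int[riesz_measure]_x (q x)%:E <= d%:E * rho [set x | (a < p x)%R].
Proof.
move=> tq d0 cp qd q0; pose V := [set x | (a < p x)%R].
have oV : open V.
  by apply: (@open_comp _ _ p [set y | (a < y)%R]) => [x _|];
    [exact: cp|exact: open_gt].
have mV := open_borel oV.
have -> : rho V = riesz_measure V by rewrite -outer_open.
apply: (@le_trans _ _ (\int[riesz_measure]_x (d * \1_V x)%:E)).
  apply: ge0_le_integral => //.
  - by move=> x _; rewrite lee_fin ctest_ge0.
  - exact: ctest_borel.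
  - exact: indicZ_borel.
  move=> x _; rewrite lee_fin indicE; case: (boolP (x \in V)) => [_|].
    by rewrite /= mulr1.
  rewrite notin_setE /V/= => /negP; rewrite -leNgt => /q0 ->.
  by rewrite mulr0.
under eq_integral do rewrite EFinM.
rewrite ge0_integralZl//; last by apply/measurable_EFinP;
  exact: measurable_indic.
by rewrite integral_indic// setIT.
Qed.

Let riesz_le p : ctest p -> \int[riesz_measure]_x (p x)%:E <= (L p)%:E.
Proof.
move=> tp; have [cp p0 _] := tp; apply/lee_addgt0Pr => e e0.
have [r rE] : exists r, rho [set x | (0 < p x)%R] = r%:E.
  exists (fine (rho [set x | (0 < p x)%R])); rewrite fineK//.
  by rewrite ge0_fin_numE// rho_fin.
have r0 : (0 <= r)%R by rewrite -lee_fin -rE.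
pose d := (e / (r + 1))%R.
have d0 : (0 < d)%R by rewrite divr_gt0// ltr_wpDl.
have dre : (d * r <= e)%R.
  by rewrite /d mulrAC ler_pdivrMr ?ltr_wpDl// ler_wpM2l ?lerDl// ltW.
clearbody d; have [M M0 pM] := ctest_bounded tp.
pose N := Num.bound (M / d)%R.
have MN : (M <= N%:R * d)%R.
  by rewrite -ler_pdivrMr// ltW// archi_boundP// ltW// divr_gt0.
pose s k x := stair d k (p x).
have ts k : ctest (s k).
  apply: (ctest_dom tp).
  - apply: continuous_minr => [|?]; last exact: cvg_cst.
    apply: continuous_maxr => [|?]; last exact: cvg_cst.
    by move=> x; apply: cvgB; [exact: cp|exact: cvg_cst].
  - by move=> x; rewrite stair_ge0// ltW.
  - by move=> x px; rewrite /s px stair_off ?(ltW d0)// mulr_ge0 ?(ltW d0).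
have pE x : p x = (\sum_(k < N.+1) s k x)%R.
  rewrite stair_sum ?(ltW d0)//; apply/esym/min_idPl.
  by rewrite (le_trans (pM x))// (le_trans MN)// ler_wpM2r ?(ltW d0)// ler_nat.
have -> : \int[riesz_measure]_x (p x)%:E =
    \sum_(k < N.+1) \int[riesz_measure]_x (s k x)%:E.
  under eq_integral do rewrite pE -sumEFin.
  rewrite ge0_integral_sum//; first by move=> k; exact: ctest_borel.
  by move=> k x _; rewrite lee_fin ctest_ge0.
rewrite big_ord_recl/= addeC; apply: leeD; last first.
  apply: le_trans (@integral_superlevel p _ d 0%R (ts 0%N) (ltW d0) cp _ _) _ => [x|x px|].
  - exact: stair_le.
  - by apply: stair_off; [exact: ltW|rewrite mul0r].
  - by rewrite rE lee_fin.
apply: (@le_trans _ _ (\sum_(k < N) (L (s k))%:E)); last first.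
  have [LE tE] := L_sum N ts.
  rewrite sumEFin -LE lee_fin; apply: le_L => // x.
  by rewrite stair_sum_le// ltW.
apply: lee_sum => k _.
apply: (@le_trans _ _ (d%:E * rho [set x | (k.+1%:R * d < p x)%R])).
  apply: (integral_superlevel (ts _) (ltW d0) cp _ _) => x.
    exact: stair_le.
  by move=> px; rewrite /s stair_off// ltW.
rewrite muleC -lee_pdivlMr//; apply: ge_ereal_sup.
move=> _ [q [tq q1 [K' [cK' K'p qK]]] <-].
rewrite -EFinM lee_fin ler_pdivlMr// mulrC -LZ ?(ltW d0)//.
apply: le_L => //; first exact: (ctestZ (ltW d0)).
move=> x; have [/K'p|/qK ->] := pselect (K' x); last by rewrite mulr0 ctest_ge0.
by rewrite /s => /stair_on ->; rewrite ger_pMr.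
Qed.

(** Given [q] equal to [1] on the support of [p] and [M] bounding [p], the
    inequality [riesz_le] for [M * q - p] reverses the one for [p], up to an
    error that vanishes as the support of [q] shrinks to that of [p]. *)
Let riesz_ge p : ctest p -> (L p)%:E <= \int[riesz_measure]_x (p x)%:E.
Proof.
move=> tp; have [cp p0 [K cK pK]] := tp; apply/lee_addgt0Pr => e e0.
have [M M0 pM] := ctest_bounded tp.
have eM : (0 < e / M)%R by rewrite divr_gt0.
have [V [oV KV rV]] := outer_approx K eM.
have [q [bq q1]] := @bump_compact R X X_lc X_hausdorff _ _ cK oV KV.
have [tq q1' _] := bq.
have LqV : (L q)%:E <= \int[riesz_measure]_x (q x)%:E + (e / M)%:E.
  apply: le_trans (_ : rho V <= _); first by apply: ereal_sup_ubound; exists q.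
  apply: le_trans rV _; rewrite leeD2r//.
  have mK := compact_borel X_hausdorff cK.
  rewrite -[outer K]/(riesz_measure K) -[in leLHS](setIT K) -integral_indic//.
  apply: ge0_le_integral => //.
  - by apply/measurable_EFinP; exact: measurable_indic.
  - exact: ctest_borel.
  - move=> x _; rewrite lee_fin indicE; case: (boolP (x \in _)) => [|_].
      by rewrite inE => /q1/nbhs_singleton ->.
    exact: ctest_ge0.
have tr : ctest (fun x => M * q x - p x)%R.
  apply: (ctest_dom tq).
  - move=> x; apply: cvgB; last exact: cp.
    by apply: cvgM; [exact: cvg_cst|case: tq => + _ _; exact].
  - move=> x; rewrite subr_ge0; have [Kx|/pK ->] := pselect (K x).
      by rewrite (nbhs_singleton (q1 _ Kx)) mulr1.
    by rewrite mulr_ge0 ?(ltW M0)// ctest_ge0.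
  - move=> x qx; rewrite qx mulr0 sub0r; apply/eqP; rewrite oppr_eq0; apply/eqP.
    apply: pK => Kx; have := nbhs_singleton (q1 _ Kx); rewrite qx => /eqP.
    by rewrite eq_sym oner_eq0.
have MqE : (fun x => M * q x)%R = (fun x => (M * q x - p x) + p x)%R.
  by apply/funext => x; lra.
have := riesz_le tr.
have LE : (M * L q = L (fun x => M * q x - p x) + L p)%R.
  by rewrite -LD// -MqE LZ// ltW.
have IE : M%:E * \int[riesz_measure]_x (q x)%:E =
    \int[riesz_measure]_x (M * q x - p x)%:E + \int[riesz_measure]_x (p x)%:E.
  rewrite -ctest_integralD// -ctest_integralZ ?(ltW M0)//.
  by apply: eq_integral => x _; rewrite subrK.
have fq := ctest_integral_fin X_hausdorff riesz_measure tq.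
have fr := ctest_integral_fin X_hausdorff riesz_measure tr.
have fp := ctest_integral_fin X_hausdorff riesz_measure tp.
rewrite -(fineK fq) -(fineK fr) -(fineK fp) in LqV IE *.
move: IE LqV; rewrite -!EFinM -!EFinD !lee_fin => -[IE] LqV.
have : (M * L q <= M * (fine (\int[riesz_measure]_x (q x)%:E)) + e)%R.
  rewrite -[e in leRHS](mulfVK (lt0r_neq0 M0)) (mulrC _ M) -mulrDr.
  by rewrite ler_pM2l.
rewrite LE IE => H1 H2; lra.
Qed.

Lemma riesz_integral p : ctest p ->
  \int[riesz_measure]_x (p x)%:E = (L p)%:E.
Proof. by move=> tp; apply/eqP; rewrite eq_le riesz_le// riesz_ge. Qed.

End riesz.

(** * Mutual energies *)

Section tensor.
Context (R : realType) (X : ptopologicalType).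
Hypothesis X_hausdorff : hausdorff_space X.
Implicit Types (p q a b : X -> R) (F : X -> X -> R).
Implicit Types (mu lam : radon_measure R X).

(** The definition is inductive because the facts needed about the iterated
    integrals of such sums are proved by adding one product at a time. *)
Inductive tensor : (X -> X -> R) -> Prop :=
| Tensor0 : tensor (fun _ _ => 0%R)
| TensorD a b F : ctest a -> ctest b -> tensor F ->
    tensor (fun x y => a x * b y + F x y)%R.

Lemma tensor1 a b : ctest a -> ctest b -> tensor (fun x y => a x * b y)%R.
Proof.
move=> ta tb; have := TensorD ta tb Tensor0.
by congr tensor; apply/funext => x; apply/funext => y; rewrite addr0.
Qed.

Lemma tensor_add F F' : tensor F -> tensor F' ->
  tensor (fun x y => F x y + F' x y)%R.
Proof.
move=> tF tF'; elim: tF => [|a b {}F ta tb _ IH].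
  by move: tF'; congr tensor; apply/funext => x; apply/funext => y;
    rewrite add0r.
have := TensorD ta tb IH.
by congr tensor; apply/funext => x; apply/funext => y; rewrite addrA.
Qed.

Lemma tensor_mull p F : continuous p -> (forall x, 0 <= p x)%R -> tensor F ->
  tensor (fun x y => p x * F x y)%R.
Proof.
move=> cp p0; elim=> [|a b {}F ta tb _ IH].
  have := Tensor0.
  by congr tensor; apply/funext => x; apply/funext => y; rewrite mulr0.
have := TensorD (ctestM ta cp p0) tb IH.
by congr tensor; apply/funext => x; apply/funext => y; rewrite mulrDr mulrA.
Qed.

Lemma tensor_swap F : tensor F -> tensor (fun x y => F y x).
Proof.
elim=> [|a b {}F ta tb _ IH]; first exact: Tensor0.
have := TensorD tb ta IH.
by congr tensor; apply/funext => x; apply/funext => y; rewrite mulrC.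
Qed.

Lemma tensor_ge0 F x y : tensor F -> (0 <= F x y)%R.
Proof.
elim=> // a b {}F ta tb _ IH.
by rewrite addr_ge0// mulr_ge0// ctest_ge0.
Qed.

Lemma tensor_section F x : tensor F -> ctest (F x).
Proof.
elim=> [|a b {}F ta tb _ IH]; first exact: ctest0.
by apply: ctestD => //; apply: ctestZ => //; exact: ctest_ge0.
Qed.

Lemma tensorD_integral a b F lam p x : ctest a -> ctest b -> tensor F ->
  \int[lam]_y (F x y)%:E = (p x)%:E ->
  \int[lam]_y (a x * b y + F x y)%:E =
  (fine (\int[lam]_y (b y)%:E) * a x + p x)%:E.
Proof.
move=> ta tb tF pE; have fb := ctest_integral_fin X_hausdorff lam tb.
rewrite ctest_integralD//; last 2 first.
- by apply: ctestZ => //; exact: ctest_ge0.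
- exact: tensor_section.
rewrite pE ctest_integralZ//; last exact: ctest_ge0.
by rewrite EFinD EFinM fineK// muleC.
Qed.

Lemma tensor_integral F lam : tensor F ->
  exists2 p, ctest p & forall x, \int[lam]_y (F x y)%:E = (p x)%:E.
Proof.
elim=> [|a b {}F ta tb tF [p tp pE]].
  by exists (fun=> 0%R); [exact: ctest0|move=> x; rewrite integral0].
exists (fun x => fine (\int[lam]_y (b y)%:E) * a x + p x)%R.
  by apply: ctestD => //; apply: ctestZ => //;
    apply/fine_ge0/ctest_integral_ge0.
by move=> x; exact: tensorD_integral.
Qed.

Definition biint F lam mu : \bar R := \int[mu]_x \int[lam]_y (F x y)%:E.

Lemma biint0 lam mu : biint (fun _ _ => 0%R) lam mu = 0.
Proof. by rewrite /biint; under eq_integral do rewrite integral0;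
  rewrite integral0. Qed.

Lemma biintD a b F lam mu : ctest a -> ctest b -> tensor F ->
  biint (fun x y => a x * b y + F x y)%R lam mu =
  \int[mu]_x (a x)%:E * \int[lam]_y (b y)%:E + biint F lam mu.
Proof.
move=> ta tb tF; have [p tp pE] := tensor_integral lam tF.
have fb := ctest_integral_fin X_hausdorff lam tb.
have -> : biint F lam mu = \int[mu]_x (p x)%:E.
  by apply: eq_integral => x _; exact: pE.
rewrite /biint; under eq_integral => x _ do rewrite (tensorD_integral ta tb tF (pE x)).
rewrite ctest_integralD//; last first.
  by apply: ctestZ => //; apply/fine_ge0/ctest_integral_ge0.
rewrite ctest_integralZ//; last by apply/fine_ge0/ctest_integral_ge0.
by rewrite fineK// muleC.
Qed.

Lemma biint_swap F lam mu : tensor F ->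
  biint F lam mu = biint (fun x y => F y x) mu lam.
Proof.
elim=> [|a b {}F ta tb tF IH]; first by rewrite !biint0.
have -> : (fun x y => a y * b x + F y x)%R = (fun x y => b x * a y + F y x)%R.
  by apply/funext => x; apply/funext => y; rewrite mulrC.
by rewrite !biintD// ?IH 1?muleC//; exact: tensor_swap.
Qed.

End tensor.

Section kernel.
Context (R : realType) (X : ptopologicalType).
Hypothesis X_lc : locally_compact [set: X].
Hypothesis X_hausdorff : hausdorff_space X.
Variable G : X * X -> \bar R.
Hypothesis G_kernel : is_kernel G.
Implicit Types (p q a b : X -> R) (F : X -> X -> R).
Implicit Types (mu lam : radon_measure R X).

Let G_ge0 z : 0 <= G z. Proof. by have [+ _ _ _] := G_kernel; exact. Qed.

Lemma kernel_section_lsc x : lower_semicontinuous (fun y => G (x, y)).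
Proof.
move=> y a aG; have [_ lG _ _] := G_kernel.
have [W [[V1 V2] /= [nV1 nV2] VW] GW] := lG (x, y) a aG.
by exists V2 => // z V2z; apply/GW/VW; split => //=; exact: nbhs_singleton.
Qed.

(** A strict inequality survives the loss of a small constant, since [b - d]
    differs from [b] by at most [d] on a set of finite measure. *)
Lemma integral_posBc lam b (c : R) : ctest b -> c%:E < \int[lam]_y (b y)%:E ->
  exists2 d : R, (0 < d)%R & c%:E < \int[lam]_y (Num.max (b y - d) 0)%:E.
Proof.
move=> tb cb; have [cb_ b0 [K cK bK]] := tb.
have [q tq [q1 qK]] := @bump_on R X X_lc X_hausdorff _ cK.
have fb := ctest_integral_fin X_hausdorff lam tb.
have fq := ctest_integral_fin X_hausdorff lam tq.
have q0 := ctest_integral_ge0 lam tq.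
move: cb; rewrite -(fineK fb) lte_fin => cb.
move: q0; rewrite -(fineK fq) lee_fin => q0.
set B := fine _ in cb; set Q := fine _ in q0.
pose d := ((B - c) / 2 / (Q + 1))%R.
have d0 : (0 < d)%R by rewrite !divr_gt0// ?subr_gt0// ltr_wpDl.
have dQ : (d * Q < B - c)%R.
  apply: (@le_lt_trans _ _ ((B - c) / 2)%R); last by lra.
  rewrite /d mulrAC ler_pdivrMr ?ltr_wpDl// ler_wpM2l ?lerDl//.
  by lra.
exists d => //.
have tbd := ctest_posBc (ltW d0) tb.
have fbd := ctest_integral_fin X_hausdorff lam tbd.
rewrite -(fineK fbd) lte_fin.
suff : \int[lam]_y (b y)%:E <=
    \int[lam]_y (Num.max (b y - d) 0 + d * q y)%:E.
  rewrite ctest_integralD//; last exact: (ctestZ (ltW d0)).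
  rewrite ctest_integralZ ?(ltW d0)// -(fineK fb) -(fineK fbd) -(fineK fq).
  by rewrite -EFinM -EFinD lee_fin -/B -/Q; lra.
apply: ctest_integral_le => //.
  by apply: continuous_lsc; have [] := ctestD tbd (ctestZ (ltW d0) tq).
move=> y; rewrite lee_fin; have [/qK ->|/bK ->] := pselect (K y).
  by rewrite mulr1 -lerBlDr le_max lexx.
by rewrite addr_ge0// ?le_max ?lexx ?orbT// mulr_ge0 ?(ltW d0)// ctest_ge0.
Qed.

(** Lower semicontinuity of [G] in both variables lets a test function lying
    below one section be pushed, after a small loss, below all nearby ones. *)
Lemma kernel_tube x0 b (d : R) : ctest b -> (0 < d)%R ->
  (forall y, (b y)%:E <= G (x0, y)) ->
  \forall x \near x0, forall y, (Num.max (b y - d) 0)%:E <= G (x, y).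
Proof.
move=> tb d0 bG; have [cb b0 [K cK bK]] := tb; have [_ lG _ _] := G_kernel.
pose I := {V : set X | nbhs x0 V}.
have [|[V nV] [W nW]|y Ky|[V nV] KV] := @compact_directed _ K I
    (fun V => [set y | forall x, sval V x -> (b y - d)%:E < G (x, y)]) cK.
- exact: (inhabits (exist _ setT filterT)).
- by exists (exist _ (V `&` W) (filterI nV nW)); split=> y /= H x [? ?];
    apply: H.
- have [|W [[V1 V2] /= [nV1 nV2] VW] GW] := lG (x0, y) (b y - d / 2)%R.
    by apply: lt_le_trans (bG y); rewrite lte_fin; lra.
  exists (exist _ V1 nV1) => /=.
  have d2 : (0 < d / 2)%R by lra.
  have /cvgrPdist_lt/(_ _ d2) := cb y; apply: filterS2 nV2 => z V2z.
  rewrite ltr_norml => bz _ x V1x.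
  apply: (@lt_trans _ _ (b y - d / 2)%:E); first by rewrite lte_fin; lra.
  by apply/GW/VW.
- apply: filterS (nV) => x Vx y.
  have [Ky|/bK ->] := pselect (K y); last first.
    by rewrite sub0r; have /max_idPr -> : (- d <= 0)%R by lra.
  by rewrite EFin_max ge_max G_ge0 andbT ltW//; exact: KV.
Qed.

Lemma potential_local lam x0 (c : R) : c%:E < potential G lam x0 ->
  exists b, [/\ ctest b, c%:E < \int[lam]_y (b y)%:E &
    \forall x \near x0, forall y, (b y)%:E <= G (x, y)].
Proof.
move=> cP.
have [b [tb bG cb]] : exists b, [/\ ctest b, forall y, (b y)%:E <= G (x0, y)
    & c%:E < \int[lam]_y (b y)%:E].
  apply: contrapT => nb; move: cP; apply/negP; rewrite -leNgt.
  apply: lsc_integral_le => //; first exact: kernel_section_lsc.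
  move=> p tp pG; rewrite leNgt; apply/negP => cp; apply: nb.
  by exists p.
have [d d0 cd] := integral_posBc tb cb.
exists (fun y => Num.max (b y - d) 0)%R; split => //.
  exact: (ctest_posBc (ltW d0)).
exact: kernel_tube.
Qed.

Lemma potential_ge0 lam x : 0 <= potential G lam x.
Proof. by apply: integral_ge0 => y _. Qed.

Lemma potential_lsc lam : lower_semicontinuous (potential G lam).
Proof.
move=> x a aP; have [b [tb ab bG]] := potential_local aP.
exists [set x | forall y, (b y)%:E <= G (x, y)] => // z zG.
apply: lt_le_trans ab _; apply: ctest_integral_le => //.
exact: kernel_section_lsc.
Qed.

Lemma biint_le F lam mu : tensor F -> (forall x y, (F x y)%:E <= G (x, y)) ->
  biint F lam mu <= \int[mu]_x potential G lam x.
Proof.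
move=> tF FG; have [p tp pE] := tensor_integral X_hausdorff lam tF.
have -> : biint F lam mu = \int[mu]_x (p x)%:E.
  by apply: eq_integral => x _; exact: pE.
apply: ctest_integral_le => //; first exact: potential_lsc.
move=> x; rewrite -pE; apply: ctest_integral_le => //.
  exact: tensor_section.
exact: kernel_section_lsc.
Qed.

(** Mutual energies are approximated from below by tensors, which gives their
    symmetry and their semicontinuity. Fubini's theorem does not apply to [G]:
    on a space without countable base, a lower semicontinuous function of two
    variables need not be measurable for the product sigma-algebra. The tensor
    [F] is glued from local ones in the manner of a partition of unity; in the
    pairs [(p, F)] below, [p] records how much of the unity is used up. *)
Lemma energy_tensor lam mu (a : R) : a%:E < \int[mu]_x potential G lam x ->
  exists F, [/\ tensor F, forall x y, (F x y)%:E <= G (x, y)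
    & a%:E < biint F lam mu].
Proof.
move=> aP.
have [f [tf fP af]] : exists p, [/\ ctest p,
    forall x, (p x)%:E <= potential G lam x & a%:E < \int[mu]_x (p x)%:E].
  apply: contrapT => nb; move: aP; apply/negP; rewrite -leNgt.
  apply: lsc_integral_le => //; first exact: potential_ge0.
    exact: potential_lsc.
  move=> p tp pG; rewrite leNgt; apply/negP => cp; apply: nb.
  by exists p.
have [d d0 ad] := integral_posBc tf af.
have [cf f0 [K cK fK]] := tf.
pose good (pF : (X -> R) * (X -> X -> R)) := [/\ ctest pF.1,
  forall x, (pF.1 x <= 1)%R, tensor pF.2,
  forall x y, (pF.2 x y)%:E <= (pF.1 x)%:E * G (x, y) &
  forall x, (pF.1 x * Num.max (f x - d) 0)%:E <= \int[lam]_y (pF.2 x y)%:E].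
have [||x0 Kx0|[[p F] [/= tp p1 tF FG Ff]] pK] := @compact_directed _ K
    {pF | good pF} (fun pF => [set x | (sval pF).1 x = 1%R]) cK.
- suff g0 : good (fun=> 0%R, fun _ _ => 0%R) by exact: (inhabits (exist _ _ g0)).
  split => //=; first exact: ctest0.
  + exact: Tensor0.
  + by move=> x y; rewrite mul0e.
  + by move=> x; rewrite mul0r integral0.
- move=> [[p F] [/= tp p1 tF FG Ff]] [[p' F'] [/= tp' p1' tF' FG' Ff']].
  have [cp p0 _] := tp; have [cp' p0' _] := tp'.
  have cp1 : continuous (fun x => 1 - p x)%R.
    by move=> x; apply: cvgB; [exact: cvg_cst|exact: cp].
  have p10 x : (0 <= 1 - p x)%R by rewrite subr_ge0.
  suff g : good (fun x => p x + (1 - p x) * p' x, fun x y => F x y + (1 - p x) * F' x y)%R.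
    exists (exist _ _ g); split=> x /= ->; last by rewrite mulr1 addrC subrK.
    by rewrite subrr mul0r addr0.
  split => /=.
  + by apply: ctestD => //; exact: ctestM.
  + move=> x; have := p1' x; have := p1 x; have := p0 x; have := p0' x; nra.
  + by apply: tensor_add => //; exact: tensor_mull.
  + move=> x y; rewrite !EFinD ge0_muleDl ?lee_fin//; last first.
      by rewrite mulr_ge0.
    apply: leeD; first exact: FG.
    rewrite !EFinM -muleA; apply: lee_pmul => //; first by rewrite lee_fin.
    by rewrite lee_fin (tensor_ge0 _ _ tF').
  + move=> x; rewrite mulrDl ctest_integralD//; last 2 first.
    * exact: tensor_section.
    * by apply: ctestZ => //; exact: tensor_section.
    rewrite EFinD; apply: leeD; first exact: Ff.
    rewrite -mulrA EFinM ctest_integralZ//; last exact: tensor_section.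
    by apply: lee_pmul => //; rewrite ?lee_fin ?mulr_ge0// le_max lexx orbT.
- have [|b [tb fb bG]] := @potential_local lam x0 (f x0 - d / 2)%R.
    by apply: lt_le_trans (fP x0); rewrite lte_fin; lra.
  have d2 : (0 < d / 2)%R by lra.
  have /cvgrPdist_lt/(_ _ d2) nf := cf x0.
  pose S := [set x | (forall y, (b y)%:E <= G (x, y)) /\ (`|f x0 - f x| < d / 2)%R].
  have oU : open S° by exact: open_interior.
  have Ux0 : S° x0 by exact: filterI bG nf.
  have UP := @interior_subset _ S.
  have [p [tp p1 [L [cL LU pL]]] np] :=
    @bump_point R X X_lc X_hausdorff _ _ oU Ux0.
  have [cp p0 _] := tp.
  suff g : good (p, fun x y => p x * b y)%R.
    by exists (exist _ _ g); apply: filterS np.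
  split => //=; first exact: tensor1.
  + move=> x y; rewrite EFinM.
    have [/LU/UP[+ _]|/pL ->] := pselect (L x); last by rewrite !mul0e.
    by move=> /(_ y) ?; apply: lee_pmul => //; rewrite lee_fin// ctest_ge0.
  + move=> x; rewrite ctest_integralZ// EFinM.
    have [/LU/UP[_]|/pL ->] := pselect (L x); last by rewrite !mul0e.
    rewrite /= ltr_norml => fx.
    apply: lee_pmul => //; rewrite ?lee_fin ?le_max ?lexx ?orbT//.
    rewrite EFin_max ge_max ctest_integral_ge0// andbT.
    by apply: le_trans (ltW fb); rewrite lee_fin; lra.
exists F; split => //.
  move=> x y; apply: le_trans (FG x y) _.
  by rewrite -[leRHS]mul1e lee_wpmul2r// lee_fin.
apply: lt_le_trans ad _.
have [r tr rE] := tensor_integral X_hausdorff lam tF.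
have -> : biint F lam mu = \int[mu]_x (r x)%:E.
  by apply: eq_integral => x _; exact: rE.
apply: ctest_integral_le; first exact: (ctest_posBc (ltW d0)).
  by apply: continuous_lsc; case: tr.
move=> x; rewrite -rE; have [Kx|/fK ->] := pselect (K x).
  by apply: le_trans (Ff x); rewrite (pK x Kx : p x = 1)%R mul1r.
have /max_idPr -> : (0 - d <= 0)%R by lra.
by apply: integral_ge0 => y _; rewrite lee_fin tensor_ge0.
Qed.

Lemma energyC lam mu :
  \int[mu]_x potential G lam x = \int[lam]_x potential G mu x.
Proof.
suff H (la m : radon_measure R X) : \int[m]_x potential G la x <= \int[la]_x potential G m x.
  by apply/eqP; rewrite eq_le !H.
apply: lee_real => a /energy_tensor[F [tF FG aF]].
apply: le_trans (ltW aF) _; rewrite biint_swap//; apply: biint_le.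
  exact: tensor_swap.
by move=> x y; have [_ _ GC _] := G_kernel; rewrite GC.
Qed.

End kernel.

(** * Vague compactness of the energy ball *)

Section vague_convergence.
Context (R : realType) (X : ptopologicalType).
Hypothesis X_hausdorff : hausdorff_space X.
Implicit Types (p q : X -> R).

Definition pairing p (mu : radon_measure R X) : R :=
  fine (\int[mu]_x (p x)%:E).

Lemma pairingE p mu : ctest p -> (pairing p mu)%:E = \int[mu]_x (p x)%:E.
Proof. by move=> tp; rewrite fineK// ctest_integral_fin. Qed.

Lemma pairing_ge0 p mu : ctest p -> (0 <= pairing p mu)%R.
Proof. by move=> tp; rewrite -lee_fin pairingE// ctest_integral_ge0. Qed.

Lemma ctest_test_function p : ctest p ->
  continuous p /\ compact (closure [set x | p x != 0%R]).
Proof.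
move=> [cp _ [K cK pK]]; split => //.
apply: (subclosed_compact _ cK); first exact: closed_closure.
have clK := compact_closed X_hausdorff cK.
rewrite [X in _ `<=` X]((closure_id _).1 clK); apply: closureS => x /= /eqP px.
by apply: contrapT => /pK.
Qed.

Lemma test_function_ctest (phi : test_function R X) :
  ctest (fun x => Num.max (sval phi x) 0)%R /\
  ctest (fun x => Num.max (- sval phi x) 0)%R.
Proof.
case: phi => p [/= cp cK].
have pK x : ~ closure [set x | p x != 0%R] x -> p x = 0%R.
  by move=> npx; apply: contrapT => /eqP px; apply: npx; exact: subset_closure.
split; split.
- by apply: continuous_maxr => // x; exact: cvg_cst.
- by move=> x; rewrite le_max lexx orbT.
- by eexists; [exact: cK|move=> x /pK ->; rewrite maxxx].
- apply: continuous_maxr => x; last exact: cvg_cst.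
  by apply: cvgN; exact: cp.
- by move=> x; rewrite le_max lexx orbT.
- by eexists; [exact: cK|move=> x /pK ->; rewrite oppr0 maxxx].
Qed.

Lemma Rintegral_test_function (phi : test_function R X)
    (mu : radon_measure R X) :
  (\int[mu]_x (sval phi x))%R =
  (pairing (fun x => Num.max (sval phi x) 0)%R mu -
   pairing (fun x => Num.max (- sval phi x) 0) mu)%R.
Proof.
have [t1 t2] := test_function_ctest phi.
have E1 : \int[mu]_x ((fun x => (sval phi x)%:E)^\+ x) =
    \int[mu]_x (Num.max (sval phi x) 0)%:E.
  by apply: eq_integral => x _; rewrite funeposE EFin_max.
have E2 : \int[mu]_x ((fun x => (sval phi x)%:E)^\- x) =
    \int[mu]_x (Num.max (- sval phi x) 0)%:E.
  by apply: eq_integral => x _; rewrite funenegE EFin_max EFinN.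
by rewrite /Rintegral integralE E1 E2 fineB ?ctest_integral_fin.
Qed.

Lemma vague_cvg (F : set_system (radon_measure R X)) (mu : radon_measure R X) :
  Filter F -> (forall p, ctest p -> pairing p @ F --> pairing p mu) ->
  F --> (mu : vague R X).
Proof.
move=> FF Fmu; apply/cvg_sup => phi A /= [_ [[B oB <-] Bmu BA]].
have [t1 t2] := test_function_ctest phi.
have cphi : (fun nu : radon_measure R X => \int[nu]_x (sval phi x))%R @ F -->
    (\int[mu]_x (sval phi x))%R.
  under eq_fun do rewrite Rintegral_test_function.
  by rewrite Rintegral_test_function; apply: cvgB; exact: Fmu.
apply: filterS BA _; apply: cphi; exact: open_nbhs_nbhs.
Qed.

Lemma pairing_continuous p : ctest p ->
  continuous (pairing p : vague R X -> R).
Proof.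
move=> tp mu; pose phi : test_function R X :=
  exist _ p (ctest_test_function tp).
have pE : pairing p = (fun nu : radon_measure R X => \int[nu]_x (sval phi x))%R.
  by apply/funext.
rewrite pE.
have /cvg_sup/(_ phi) : nbhs (mu : vague R X) --> (mu : vague R X) by [].
move=> cmu A nA; apply: cmu.
exact: (@initial_continuous _ _
  (fun nu : radon_measure R X => (\int[nu]_x sval phi x)%R) mu A nA).
Qed.

Lemma biint_fin F (lam mu : radon_measure R X) : tensor F ->
  biint F lam mu \is a fin_num.
Proof.
elim=> [|a b {}F ta tb tF IH]; first by rewrite biint0.
by rewrite biintD// fin_numD IH fin_numM// ctest_integral_fin.
Qed.

Lemma biint_cvg F (U : set_system (radon_measure R X)) (mu : radon_measure R X) :
  Filter U -> (forall p, ctest p -> pairing p @ U --> pairing p mu) ->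
  tensor F ->
  (fun nu => fine (biint F nu nu)) @ U --> fine (biint F mu mu).
Proof.
move=> FU Umu; elim=> [|a b {}F ta tb tF IH].
  by rewrite biint0; under eq_fun do rewrite biint0; exact: cvg_cst.
have E nu : fine (biint (fun x y => a x * b y + F x y)%R nu nu) =
    (pairing a nu * pairing b nu + fine (biint F nu nu))%R.
  rewrite biintD// fineD ?biint_fin// ?fineM// ?ctest_integral_fin//.
  by rewrite fin_numM ?ctest_integral_fin.
rewrite E; under eq_fun do rewrite E.
by apply: cvgD => //; apply: cvgM; exact: Umu.
Qed.

End vague_convergence.

Section ball.
Context (R : realType) (X : ptopologicalType).
Hypothesis X_lc : locally_compact [set: X].
Hypothesis X_hausdorff : hausdorff_space X.
Variable G : X * X -> \bar R.
Hypothesis G_kernel : is_kernel G.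
Implicit Types (p q : X -> R) (mu : radon_measure R X).

Lemma energy_ballP mu : energy_ball G mu <-> \int[mu]_x potential G mu x <= 1.
Proof.
rewrite /energy_ball/= /energy_norm -[X in _ <= X <-> _](_ : sqrte 1 = 1)%E.
  by rewrite lee_sqrt.
by rewrite /= sqrtr1.
Qed.

(** Near a point of the diagonal [G] is bounded below by some [a > 0], and a
    test function [q <= 1] living there satisfies [a * (int q dmu) ^ 2 <= 1]
    for every [mu] in the energy ball. *)
Lemma ball_bounded p : ctest p ->
  exists2 M : R, (0 <= M)%R & forall mu, energy_ball G mu ->
    \int[mu]_x (p x)%:E <= M%:E.
Proof.
move=> tp; have [cp p0 [K cK pK]] := tp.
pose good (qM : (X -> R) * R) := ctest qM.1 /\ forall mu, energy_ball G mu ->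
    \int[mu]_x (qM.1 x)%:E <= qM.2%:E.
have [|[[q M] [/= tq qM]] [[q' M'] [/= tq' qM']]|x0 Kx0|[[q M] [/= tq qM]] qK] :=
  @compact_directed _ K {qM | good qM}
    (fun qM => [set x | (1 <= (sval qM).1 x)%R]) cK.
- suff g0 : good (fun=> 0%R, 0%R) by exact: (inhabits (exist _ _ g0)).
  by split => /= [|mu _]; [exact: ctest0|rewrite integral0].
- suff g : good (fun x => q x + q' x, M + M')%R.
    exists (exist _ _ g); split=> x /= qx.
      by rewrite (le_trans qx)// lerDl ctest_ge0.
    by rewrite (le_trans qx)// lerDr ctest_ge0.
  split => /= [|mu bmu]; first exact: ctestD.
  by rewrite ctest_integralD// EFinD leeD// ?qM ?qM'.
- have [_ lG _ Gd] := G_kernel.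
  have [a a0 aG] : exists2 a : R, (0 < a)%R & a%:E < G (x0, x0).
    have := Gd x0; case: (G (x0, x0)) => [r| |]//; last first.
      by exists 1%R; rewrite ?ltr01 ?ltry.
    by rewrite lte_fin => r0; exists (r / 2)%R; rewrite ?lte_fin; lra.
  have [W [[V1 V2] /= [nV1 nV2] VW] GW] := lG _ _ aG.
  pose V := (V1 `&` V2)°.
  have oV : open V by exact: open_interior.
  have Vx0 : V x0 by exact: filterI.
  have [q [tq q1 [L [cL LV qL]]] nq] :=
    @bump_point R X X_lc X_hausdorff _ _ oV Vx0.
  suff g : good (q, 1 + a^-1)%R.
    by exists (exist _ _ g); apply: filterS nq => y /= -> _.
  split => //= mu /energy_ballP bmu.
  have q0 := ctest_ge0 _ tq.
  have taq := ctestZ (ltW a0) tq.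
  have tF := tensor1 taq tq.
  have := le_trans (@biint_le _ _ X_lc X_hausdorff G G_kernel _ mu mu tF _) bmu.
  have -> : biint (fun x y => a * q x * q y)%R mu mu =
      (a * pairing q mu * pairing q mu)%:E.
    have -> : (fun x y => a * q x * q y)%R =
        (fun x y => (a * q x) * q y + 0)%R.
      by apply/funext => x; apply/funext => y; rewrite addr0.
    rewrite biintD//; last exact: Tensor0.
    by rewrite biint0 adde0 ctest_integralZ ?(ltW a0)// !EFinM !pairingE.
  rewrite -pairingE// !lee_fin => H.
  have {}H : (a * pairing q mu * pairing q mu <= 1)%R.
    apply: H => x y.
    have [/LV/interior_subset[V1x _]|/qL ->] := pselect (L x); last first.
      by rewrite mulr0 mul0r; have [+ _ _ _] := G_kernel; exact.
    have [/LV/interior_subset[_ V2y]|/qL ->] := pselect (L y); last first.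
      by rewrite mulr0; have [+ _ _ _] := G_kernel; exact.
    apply: le_trans (ltW (GW (x, y) _)); last exact: VW.
    rewrite lee_fin -mulrA ger_pMr// mulr_ile1//.
  rewrite leNgt; apply/negP => lt_q.
  have aV : (0 < a^-1)%R by rewrite invr_gt0.
  have aa : (a * a^-1 = 1)%R by rewrite divff// gt_eqF.
  set t := pairing q mu in H lt_q; nra.
have [C C0 pC] := ctest_bounded tp.
have M0 : (0 <= M * C)%R \/ forall mu, ~ energy_ball G mu.
  have [[mu bmu]|nb] := pselect (exists mu, energy_ball G mu); last first.
    by right=> mu bmu; apply: nb; exists mu.
  left; rewrite mulr_ge0 ?(ltW C0)// -lee_fin (le_trans _ (qM mu bmu))//.
  exact: ctest_integral_ge0.
case: M0 => [M0|nb]; last by exists 0%R => // mu /nb.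
exists (M * C)%R => // mu bmu.
apply: (@le_trans _ _ (\int[mu]_x (C * q x)%:E)).
  apply: ctest_integral_le => //.
    by apply: continuous_lsc; have [] := ctestZ (ltW C0) tq.
  move=> x; rewrite lee_fin; have [/qK /= qx|/pK ->] := pselect (K x).
    by rewrite (le_trans (pC x))// ler_peMr// ltW.
  by rewrite mulr_ge0 ?(ltW C0)// ctest_ge0.
rewrite ctest_integralZ ?(ltW C0)// muleC EFinM lee_wpmul2r ?lee_fin ?(ltW C0)//.
exact: qM.
Qed.

End ball.

Section ball_compact.
Context (R : realType) (X : ptopologicalType).
Hypothesis X_lc : locally_compact [set: X].
Hypothesis X_hausdorff : hausdorff_space X.
Variable G : X * X -> \bar R.
Hypothesis G_kernel : is_kernel G.
Implicit Types (p q : X -> R) (mu : radon_measure R X).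

Lemma ultra_cvg_bounded (T : Type) (F : set_system T) (u : T -> R) (M : R) :
  UltraFilter F -> F [set t | 0 <= u t <= M]%R -> exists l : R, u @ F --> l.
Proof.
move=> UF Fu.
have PF : ProperFilter (u @ F) by exact: fmap_proper_filter.
have [l [_ cl]] : exists l, `[0%R, M]%classic l /\ cluster (u @ F) l.
  have [|l [? ?]] := @segment_compact R 0%R M (u @ F) PF.
    by rewrite /= /fmap/=; apply: filterS Fu => t /=; rewrite in_itv.
  by exists l.
exists l; apply/cvg_ballP => e e0.
pose A := [set t | ball l e (u t)].
have [//|FA] := in_ultra_setVsetC A UF.
have uA : (u @ F) (~` ball l e) by exact: FA.
by have [y [nAy /nAy]] := cl _ _ uA (nbhsx_ballx l e e0).
Qed.

(** Along an ultrafilter on the energy ball the integrals of each test function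
    converge; the limits form a positive linear form, hence a Radon measure,
    whose energy is controlled by the tensors below [G]. *)
Lemma energy_ball_compact : compact (energy_ball G : set (vague R X)).
Proof.
rewrite compact_ultra => F UF FB.
have cvgF p : ctest p -> exists l : R, pairing p @ F --> l.
  move=> tp; have [M M0 pM] := ball_bounded X_lc X_hausdorff G_kernel tp.
  apply: (@ultra_cvg_bounded _ F _ M); apply: filterS FB => mu bmu /=.
  rewrite pairing_ge0//=.
  by rewrite -lee_fin pairingE//; exact: pM.
have /choice[L LP] p : exists l : R, ctest p -> pairing p @ F --> l.
  have [tp|ntp] := pselect (ctest p); last by exists 0%R.
  by have [l] := cvgF p tp; exists l.
have L_ge0 p : ctest p -> (0 <= L p)%R.
  move=> tp; apply: (cvgr_to_ge (LP p tp)); near=> mu; exact: pairing_ge0.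
have LD p q : ctest p -> ctest q -> L (fun x => p x + q x)%R = (L p + L q)%R.
  move=> tp tq; have tpq := ctestD tp tq.
  apply: (@cvg_unique R^o (@norm_hausdorff R R^o) _ _ _ _ (LP _ tpq)).
  rewrite (_ : pairing _ = fun mu => (pairing p mu + pairing q mu)%R).
    by apply: cvgD; exact: LP.
  apply/funext => mu; rewrite /pairing ctest_integralD// fineD//;
    exact: ctest_integral_fin.
have LZ (a : R) p : (0 <= a)%R -> ctest p ->
  L (fun x => a * p x)%R = (a * L p)%R.
  move=> a0 tp; have tap := ctestZ a0 tp.
  apply: (@cvg_unique R^o (@norm_hausdorff R R^o) _ _ _ _ (LP _ tap)).
  rewrite (_ : pairing _ = fun mu => (a * pairing p mu)%R).
    by apply: cvgM; [exact: cvg_cst|exact: LP].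
  apply/funext => mu; rewrite /pairing ctest_integralZ// fineM//.
  exact: ctest_integral_fin.
pose nu := riesz_measure X_lc X_hausdorff L_ge0 LD LZ.
have nuE p : ctest p -> pairing p nu = L p.
  by move=> tp; rewrite /pairing riesz_integral.
have Fnu p : ctest p -> pairing p @ F --> pairing p nu.
  by move=> tp; rewrite nuE//; exact: LP.
exists nu; split; last exact: vague_cvg.
apply: (energy_ballP G nu).2; apply: lee_real => a.
move=> /(energy_tensor X_lc X_hausdorff G_kernel)[H [tH HG aH]].
apply: le_trans (ltW aH) _.
rewrite -[leLHS]fineK ?biint_fin// lee_fin.
apply: (cvgr_to_le (biint_cvg X_hausdorff _ Fnu tH)).
apply: filterS FB => mu /(energy_ballP G) bmu.
rewrite -lee_fin fineK ?biint_fin//; apply: le_trans bmu.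
exact: biint_le.
Unshelve. all: end_near. Qed.

End ball_compact.

(** * Operations on measures *)

Section pairing_theory.
Context (R : realType) (X : ptopologicalType).
Hypothesis X_lc : locally_compact [set: X].
Hypothesis X_hausdorff : hausdorff_space X.
Implicit Types (p q a b h : X -> R) (F : X -> X -> R).
Implicit Types (mu nu lam : radon_measure R X).

Lemma pairingD p q mu : ctest p -> ctest q ->
  pairing (fun x => p x + q x)%R mu = (pairing p mu + pairing q mu)%R.
Proof.
by move=> tp tq; rewrite /pairing ctest_integralD// fineD// ctest_integral_fin.
Qed.

Lemma pairingZ (s : R) p mu : (0 <= s)%R -> ctest p ->
  pairing (fun x => s * p x)%R mu = (s * pairing p mu)%R.
Proof.
by move=> s0 tp; rewrite /pairing ctest_integralZ// fineM// ctest_integral_fin.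
Qed.

Lemma pairing_le p q mu : ctest p -> ctest q -> (forall x, p x <= q x)%R ->
  (pairing p mu <= pairing q mu)%R.
Proof.
move=> tp tq pq; rewrite -lee_fin !pairingE//; apply: ctest_integral_le => //.
by apply: continuous_lsc; case: tq.
Qed.

(** Sums and densities are formed on linear forms rather than on measures: if
    [X] is not sigma-compact, the set function sending [A] to the integral of
    [h] over [A] may fail to be outer regular. *)
Lemma radon_of_form (L : (X -> R) -> R) :
  (forall p, ctest p -> 0 <= L p)%R ->
  (forall p q, ctest p -> ctest q -> L (fun x => p x + q x) = L p + L q)%R ->
  (forall (s : R) p, 0 <= s -> ctest p -> L (fun x => s * p x) = s * L p)%R ->
  exists nu, forall p, ctest p -> pairing p nu = L p.
Proof.
move=> L0 LD LZ; exists (riesz_measure X_lc X_hausdorff L0 LD LZ) => p tp.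
by rewrite /pairing riesz_integral.
Qed.

Lemma radon_mix lam mu (s t : R) : (0 <= s)%R -> (0 <= t)%R ->
  exists nu, forall p, ctest p ->
    pairing p nu = (s * pairing p lam + t * pairing p mu)%R.
Proof.
move=> s0 t0.
apply: (@radon_of_form (fun p => s * pairing p lam + t * pairing p mu)%R).
- by move=> p tp; rewrite addr_ge0// mulr_ge0// pairing_ge0.
- by move=> p q tp tq; rewrite !pairingD//; ring.
- by move=> r p r0 tp; rewrite !pairingZ//; ring.
Qed.

Lemma radon_density mu h : continuous h -> (forall x, 0 <= h x)%R ->
  exists nu, forall p, ctest p ->
    pairing p nu = pairing (fun x => h x * p x)%R mu.
Proof.
move=> ch h0.
apply: (@radon_of_form (fun p => pairing (fun x => h x * p x)%R mu)).
- by move=> p tp; apply/pairing_ge0/ctestM.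
- move=> p q tp tq; rewrite -pairingD; [|exact: ctestM..].
  by congr pairing; apply/funext => x; rewrite mulrDr.
- move=> r p r0 tp; rewrite -pairingZ//; last exact: ctestM.
  by congr pairing; apply/funext => x; rewrite mulrCA.
Qed.

Definition rbiint F lam mu : R := fine (biint F lam mu).

Lemma rbiint0 lam mu : rbiint (fun _ _ => 0%R) lam mu = 0%R.
Proof. by rewrite /rbiint biint0. Qed.

Lemma rbiintD a b F lam mu : ctest a -> ctest b -> tensor F ->
  rbiint (fun x y => a x * b y + F x y)%R lam mu =
  (pairing a mu * pairing b lam + rbiint F lam mu)%R.
Proof.
move=> ta tb tF; rewrite /rbiint biintD// fineD ?biint_fin//.
  by rewrite fineM ?ctest_integral_fin.
by rewrite fin_numM ?ctest_integral_fin.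
Qed.

Lemma rbiint_mix lam mu nu (s t : R) F : tensor F ->
  (forall p, ctest p ->
    pairing p nu = (s * pairing p lam + t * pairing p mu)%R) ->
  rbiint F nu nu = (s ^+ 2 * rbiint F lam lam + s * t * (rbiint F lam mu + rbiint F mu lam) +
    t ^+ 2 * rbiint F mu mu)%R.
Proof.
move=> tF nuE; elim: tF => [|a b {}F ta tb tF IH];
  first by rewrite !rbiint0; ring.
by rewrite !rbiintD// IH !nuE//; ring.
Qed.

Lemma rbiint_density mu nu h F : continuous h -> (forall x, 0 <= h x)%R ->
  tensor F ->
  (forall p, ctest p -> pairing p nu = pairing (fun x => h x * p x)%R mu) ->
  tensor (fun x y => h x * h y * F x y)%R /\
  rbiint F nu nu = rbiint (fun x y => h x * h y * F x y)%R mu mu.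
Proof.
move=> ch h0 tF nuE; elim: tF => [|a b {}F ta tb tF [tF' IH]].
  have -> : (fun x y => h x * h y * 0)%R = (fun _ _ => 0)%R.
    by apply/funext => x; apply/funext => y; rewrite mulr0.
  by rewrite !rbiint0; split => //; exact: Tensor0.
have -> : (fun x y => h x * h y * (a x * b y + F x y))%R =
    (fun x y => (h x * a x) * (h y * b y) + h x * h y * F x y)%R.
  by apply/funext => x; apply/funext => y; ring.
have tha := ctestM ta ch h0; have thb := ctestM tb ch h0.
by split; [exact: TensorD|rewrite !rbiintD// IH !nuE].
Qed.

End pairing_theory.

Section energy.
Context (R : realType) (X : ptopologicalType).
Hypothesis X_lc : locally_compact [set: X].
Hypothesis X_hausdorff : hausdorff_space X.
Variable G : X * X -> \bar R.
Hypothesis G_kernel : is_kernel G.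
Implicit Types (p q h phi psi : X -> R) (g u : X -> \bar R) (F : X -> X -> R).
Implicit Types (mu nu lam : radon_measure R X).

Local Notation E1 := (energy_ball G).

Lemma energy_ball_tensor mu :
  (forall F, tensor F -> (forall x y, (F x y)%:E <= G (x, y)) ->
    (rbiint F mu mu <= 1)%R) -> E1 mu.
Proof.
move=> H; apply: (energy_ballP G mu).2; apply: lee_real => a.
move=> /(energy_tensor X_lc X_hausdorff G_kernel)[F [tF FG aF]].
by apply: le_trans (ltW aF) _; rewrite -(fineK (biint_fin X_hausdorff mu mu tF))
  lee_fin; exact: H.
Qed.

Lemma energy_ball_density mu nu h : E1 mu -> continuous h ->
  (forall x, 0 <= h x <= 1)%R ->
  (forall p, ctest p -> pairing p nu = pairing (fun x => h x * p x)%R mu) ->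
  E1 nu.
Proof.
move=> /(energy_ballP G) bmu ch h01 nuE; apply: energy_ball_tensor => F tF FG.
have h0 x : (0 <= h x)%R by have /andP[] := h01 x.
have [tF' ->] := rbiint_density X_hausdorff ch h0 tF nuE.
rewrite -lee_fin /rbiint fineK ?biint_fin//; apply: le_trans bmu.
apply: biint_le => // x y; apply: le_trans (FG x y).
rewrite lee_fin ler_piMl// ?(tensor_ge0 _ _ tF)//.
by have /andP[? ?] := h01 x; have /andP[? ?] := h01 y; rewrite mulr_ile1.
Qed.

Lemma energy_ball0 : exists mu, E1 mu.
Proof.
have [|||mu muE] := @radon_of_form R X X_lc X_hausdorff (fun=> 0%R) => //.
- by move=> p q _ _; rewrite addr0.
- by move=> s p _ _; rewrite mulr0.
exists mu; apply: energy_ball_tensor => F tF _.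
suff -> : rbiint F mu mu = 0%R by [].
elim: tF => [|a b {}F ta tb tF IH]; first by rewrite rbiint0.
by rewrite rbiintD// IH !muE// mul0r addr0.
Qed.

(** * Consistency *)

Hypothesis G_consistent : consistent G.

Definition mutual_energy lam mu : R := fine (\int[mu]_x potential G lam x).

Local Notation En := mutual_energy.

Lemma energy_ball_finite lam : E1 lam -> finite_energy G lam.
Proof. by rewrite /energy_ball/finite_energy/= => /le_lt_trans -> //;
  rewrite ltry. Qed.

Lemma mutual_energyE lam mu : E1 lam -> E1 mu ->
  (En lam mu)%:E = \int[mu]_x potential G lam x.
Proof.
by move=> bl bm; rewrite fineK//; have [+ _] :=
  G_consistent (energy_ball_finite bl); exact.
Qed.

Lemma mutual_energyC lam mu : En lam mu = En mu lam.
Proof. by rewrite /mutual_energy (energyC X_lc X_hausdorff G_kernel). Qed.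

Lemma mutual_energy_ge0 lam mu : (0 <= En lam mu)%R.
Proof.
by apply/fine_ge0/integral_ge0 => x _; exact: potential_ge0.
Qed.

Lemma mutual_energy_near lam mu (e : R) : E1 lam -> E1 mu -> (0 < e)%R ->
  \forall nu \near (mu : vague R X), E1 nu -> (`|En lam mu - En lam nu| < e)%R.
Proof.
move=> bl bm e0; have [fl cl] := G_consistent (energy_ball_finite bl).
have cm := (subspace_continuousP _ _).1 cl mu bm.
have /fine_cvg/cvgrPdist_lt/(_ e e0) : (fun nu : vague R X =>
    \int[(nu : radon_measure R X)]_x potential G lam x) @
    within (E1 : set (vague R X)) (nbhs (mu : vague R X)) --> (En lam mu)%:E.
  by rewrite mutual_energyE//; exact: cm.
exact.
Qed.

Lemma rbiint_le F lam mu : tensor F -> (forall x y, (F x y)%:E <= G (x, y)) ->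
  E1 lam -> E1 mu -> (rbiint F lam mu <= En lam mu)%R.
Proof.
move=> tF FG bl bm; rewrite -lee_fin mutual_energyE// fineK ?biint_fin//.
exact: biint_le.
Qed.

Lemma mutual_energy_diag mu : E1 mu -> (En mu mu <= 1)%R.
Proof. by move=> bm; rewrite -lee_fin mutual_energyE//;
  apply/(energy_ballP G). Qed.

End energy.

(** * Duality *)

Section duality.
Context (R : realType) (X : ptopologicalType).
Hypothesis X_lc : locally_compact [set: X].
Hypothesis X_hausdorff : hausdorff_space X.
Variable G : X * X -> \bar R.
Hypothesis G_kernel : is_kernel G.
Hypothesis G_consistent : consistent G.
Implicit Types (p q h phi psi : X -> R) (g u : X -> \bar R).
Implicit Types (mu nu lam : radon_measure R X).

Local Notation E1 := (energy_ball G).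
Local Notation En := (mutual_energy G).

Lemma lsc_pairing_gt mu g (c : R) : (forall x, 0 <= g x) ->
  lower_semicontinuous g -> c%:E < \int[mu]_x g x ->
  exists p, [/\ ctest p, forall x, (p x)%:E <= g x & (c < pairing p mu)%R].
Proof.
move=> g0 lg cg; apply: contrapT => np; move: cg; apply/negP; rewrite -leNgt.
apply: lsc_integral_le => // p tp pg; rewrite leNgt; apply/negP => cp.
by apply: np; exists p; split => //; rewrite -lte_fin pairingE.
Qed.

Lemma pairing_near phi mu (e : R) : ctest phi -> (0 < e)%R ->
  \forall nu \near (mu : vague R X), (`|pairing phi mu - pairing phi nu| < e)%R.
Proof.
move=> tphi e0; have cphi := pairing_continuous X_hausdorff tphi.
by have /cvgrPdist_lt/(_ e e0) := cphi mu.
Qed.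

(** If [lam] maximizes the integral of [phi] on the energy ball, its multiple
    by the maximum is a measure whose potential dominates [phi] in the mean
    with respect to every measure of the ball. This is the Euler-Lagrange
    inequality: perturb [lam] to [(lam + t * mu) / r], where
    [r = 1 + t * En lam mu + t ^ 2] is chosen to keep the energy at most [1]. *)
Lemma exists_equilibrium phi : ctest phi -> exists2 lam, E1 lam &
  forall mu, E1 mu -> (pairing phi mu <= pairing phi lam * En lam mu)%R.
Proof.
move=> tphi.
have [lam|lam /set_mem blam lam_max] :=
    @compact_EVT_max (vague R X) R (pairing phi) E1
      (energy_ball0 X_lc X_hausdorff G_kernel)
      (energy_ball_compact X_lc X_hausdorff G_kernel).
  by apply: continuous_subspaceT => x; exact: pairing_continuous.
exists lam => // mu bmu; set m := pairing phi mu; set c := pairing phi lam.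
have c0 : (0 <= c)%R by exact: pairing_ge0.
pose A := En lam mu; have A0 : (0 <= A)%R by exact: mutual_energy_ge0.
apply/ler_addgt0Pr => e e0.
pose t := (e / (c + 1))%R.
have t0 : (0 < t)%R by rewrite divr_gt0// ltr_wpDl.
have cte : (c * t <= e)%R.
  by rewrite /t mulrCA ger_pMr// ler_pdivrMr ?ltr_wpDl// mul1r lerDl.
clearbody t; pose r := (1 + t * A + t ^+ 2)%R.
have r0 : (0 < r)%R by rewrite /r; nra.
have rE : (1 + 2 * t * A + t ^+ 2 <= r ^+ 2)%R.
  have tA : (0 <= t * A)%R by rewrite mulr_ge0// ltW.
  by rewrite /r; nra.
pose i := (r^-1)%R; have i0 : (0 <= i)%R by rewrite invr_ge0 ltW.
have ir : (i * r = 1)%R by rewrite mulVf// gt_eqF.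
have ti0 : (0 <= t * i)%R by rewrite mulr_ge0// ltW.
have [nu nuE] := radon_mix X_lc X_hausdorff lam mu i0 ti0.
have bnu : E1 nu.
  apply: energy_ball_tensor => // F tF FG.
  rewrite (rbiint_mix X_hausdorff tF nuE).
  have b1 := rbiint_le X_lc X_hausdorff G_kernel G_consistent tF FG blam blam.
  have b2 := rbiint_le X_lc X_hausdorff G_kernel G_consistent tF FG blam bmu.
  have b3 := rbiint_le X_lc X_hausdorff G_kernel G_consistent tF FG bmu blam.
  have b4 := rbiint_le X_lc X_hausdorff G_kernel G_consistent tF FG bmu bmu.
  have d1 := mutual_energy_diag G_consistent blam; have d2 :=
    mutual_energy_diag G_consistent bmu.
  rewrite (mutual_energyC X_lc X_hausdorff G_kernel) -/A in b3;
    rewrite -/A in b2.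
  set x := rbiint F lam lam in b1 *; set y := rbiint F lam mu in b2 *.
  set z := rbiint F mu lam in b3 *; set w := rbiint F mu mu in b4 *.
  have -> : (i ^+ 2 * x + i * (t * i) * (y + z) + (t * i) ^+ 2 * w =
    i ^+ 2 * (x + t * (y + z) + t ^+ 2 * w))%R by ring.
  have -> : (1 = i ^+ 2 * r ^+ 2)%R by rewrite -exprMn ir expr1n.
  rewrite ler_wpM2l ?exprn_ge0//; apply: le_trans rE.
  have : (t * (y + z) <= t * (A + A))%R by rewrite ler_pM2l// lerD.
  have : (t ^+ 2 * w <= t ^+ 2 * 1)%R.
    by rewrite ler_wpM2l ?exprn_ge0 ?(ltW t0)// (le_trans b4).
  have : (x <= 1)%R by exact: le_trans b1 d1.
  by lra.
have := lam_max nu (mem_set bnu); rewrite nuE// -/m -/c => H.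
have : (r * (i * c + t * i * m) <= r * c)%R by rewrite ler_pM2l.
have -> : (r * (i * c + t * i * m) = (i * r) * c + (i * r) * t * m)%R by ring.
rewrite ir !mul1r => {}H.
have : (t * m <= t * (c * A + e))%R.
  have : (t * (c * t) <= t * e)%R by rewrite ler_pM2l.
  by move: H; rewrite /r; lra.
by rewrite ler_pM2l.
Qed.

(** For lower semicontinuous [g] this says that [c] bounds both the capacity of
    [g] and the integrals of [g] over the energy ball. *)
Definition ball_le g (c : R) := forall p, ctest p ->
  (forall x, (p x)%:E <= g x) ->
  forall mu, E1 mu -> (pairing p mu <= c)%R.

(** The equilibrium measures of the test functions below [g] stay in a compact
    set, on which, by consistency, the inequalities to be satisfied are closed
    conditions; these get stronger as the test function increases. *)
Lemma exists_dominating g (s : R) : (forall x, 0 <= g x) -> (0 <= s)%R ->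
  ball_le g s ->
  exists2 lam, E1 lam & forall p, ctest p -> (forall x, (p x)%:E <= g x) ->
    forall mu, E1 mu -> (pairing p mu <= s * En lam mu)%R.
Proof.
move=> g0 s0 gs; apply: contrapT => nlam.
pose good p := ctest p /\ forall x, (p x)%:E <= g x.
have [|[p [tp pg]] [q [tq qg]]|lam blam|[p [/= tp pg]] pK] :=
  @compact_directed (vague R X) E1 {p | good p} (fun z => [set lam |
    exists2 mu, E1 mu & (s * En lam mu < pairing (sval z) mu)%R])
    (energy_ball_compact X_lc X_hausdorff G_kernel).
- have gg : good (fun=> 0%R) by split => //; exact: ctest0.
  exact: (inhabits (exist _ _ gg)).
- have gg : good (fun x => Num.max (p x) (q x)).
    split => [|x]; first exact: ctest_max.
    by rewrite EFin_max ge_max pg qg.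
  exists (exist _ _ gg).
  split=> lam /= [mu bmu H]; exists mu => //; apply: lt_le_trans H _;
    apply: pairing_le => //; try exact: ctest_max.
    by move=> x; rewrite le_max lexx.
  by move=> x; rewrite le_max lexx orbT.
- have [p [tp pg [mu bmu H]]] : exists p, [/\ ctest p,
      forall x, (p x)%:E <= g x &
      exists2 mu, E1 mu & (s * En lam mu < pairing p mu)%R].
    apply: contrapT => np; apply: nlam; exists lam => // p tp pg mu bmu.
    rewrite leNgt; apply/negP => H; apply: np; exists p; split => //.
    by exists mu.
  have gg : good p by [].
  exists (exist _ _ gg) => /=.
  pose e := ((pairing p mu - s * En lam mu) / (s + 1))%R.
  have e0 : (0 < e)%R by rewrite divr_gt0// ?subr_gt0// ltr_wpDl.
  have se : (s * e < pairing p mu - s * En lam mu)%R.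
    rewrite /e mulrCA gtr_pMr ?subr_gt0// ltr_pdivrMr ?ltr_wpDl// mul1r.
    by rewrite ltrDl.
  have := mutual_energy_near G_consistent bmu blam e0;
    apply: filterS => nu Hnu bnu.
  exists mu => //; have := Hnu bnu.
  rewrite !(mutual_energyC X_lc X_hausdorff G_kernel mu) ltr_norml => /andP[H1 _].
  have : (s * En nu mu <= s * (En lam mu + e))%R by rewrite ler_wpM2l//; lra.
  by move=> H2; apply: le_lt_trans H2 _; lra.
have [lam blam lamP] := exists_equilibrium tp.
have [mu bmu] := pK lam blam; apply/negP; rewrite -leNgt.
apply: le_trans (lamP mu bmu) _.
by rewrite ler_wpM2r ?mutual_energy_ge0//; exact: gs.
Qed.

(** Consistency makes potentials uniformly approximable: by Dini's theorem on
    the compact energy ball, test functions below the potential exhaust it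
    uniformly over all measures of the ball. *)
Lemma exists_minorant lam (e : R) : E1 lam -> (0 < e)%R ->
  exists psi, [/\ ctest psi, forall x, (psi x)%:E <= potential G lam x &
    forall mu, E1 mu -> (En lam mu <= pairing psi mu + e)%R].
Proof.
move=> blam e0.
pose good p := ctest p /\ forall x, (p x)%:E <= potential G lam x.
have [|[p [tp pg]] [q [tq qg]]|mu bmu|[p [/= tp pg]] pK] :=
  @compact_directed (vague R X) E1 {p | good p} (fun z => [set mu |
    (En lam mu <= pairing (sval z) mu + e)%R])
    (energy_ball_compact X_lc X_hausdorff G_kernel).
- have gg : good (fun=> 0%R).
    by split => [|x]; [exact: ctest0|exact: potential_ge0].
  exact: (inhabits (exist _ _ gg)).
- have gg : good (fun x => Num.max (p x) (q x)).
    split => [|x]; first exact: ctest_max.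
    by rewrite EFin_max ge_max pg qg.
  exists (exist _ _ gg).
  split=> mu /= /le_trans; apply; rewrite lerD2r;
    apply: pairing_le => //; try exact: ctest_max.
    by move=> x; rewrite le_max lexx.
  by move=> x; rewrite le_max lexx orbT.
- have [|p [tp pg H]] :=
    @lsc_pairing_gt mu (potential G lam) (En lam mu - e / 3)%R
    (potential_ge0 G_kernel lam) (@potential_lsc _ _ X_lc X_hausdorff G G_kernel lam).
    by rewrite -(mutual_energyE G_consistent blam bmu) lte_fin; lra.
  have gg : good p by [].
  exists (exist _ _ gg) => /=.
  have e3 : (0 < e / 3)%R by lra.
  have := mutual_energy_near G_consistent blam bmu e3.
  apply: filterS2 (pairing_near mu tp e3) => nu pnu Hnu bnu.
  by have := Hnu bnu; move: pnu; rewrite !ltr_norml; lra.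
by exists p.
Qed.

End duality.

(** * Lower semicontinuous functions *)

Section lsc.
Context (R : realType) (X : ptopologicalType).
Implicit Types (f g u : X -> \bar R) (psi : X -> R).

Lemma lee_real_between (x : \bar R) (a : R) : a%:E < x ->
  exists2 b : R, (a < b)%R & b%:E < x.
Proof.
case: x => [r| |]// ax; last by exists (a + 1)%R; rewrite ?ltrDl ?ltry.
rewrite lte_fin in ax; exists ((a + r) / 2)%R; rewrite ?lte_fin; lra.
Qed.

Lemma lscplus_posB g psi : lscplus g -> continuous psi ->
  lscplus (fun x => maxe (g x - (psi x)%:E) 0).
Proof.
move=> [g0 lg] cpsi; split; first by move=> x; rewrite le_max lexx orbT.
move=> x a; rewrite lt_max => /orP[|a0]; last first.
  exists setT; first exact: filterT.
  by move=> y _; rewrite lt_max a0 orbT.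
rewrite lteBrDr// -EFinD => /lee_real_between[b ab /lg[V nV Vg]].
have e0 : (0 < b - (a + psi x))%R by lra.
exists (V `&` [set y | `|psi x - psi y| < b - (a + psi x)]%R).
  by apply: filterI nV _; have /cvgrPdist_lt/(_ _ e0) := cpsi x.
move=> y [Vy psiy]; move: (psiy : (`|psi x - psi y| < _)%R).
rewrite ltr_norml => {}psiy.
rewrite lt_max; apply/orP; left; rewrite lteBrDr// -EFinD.
by apply: le_lt_trans (Vg _ Vy); rewrite lee_fin; lra.
Qed.

Lemma lscplus0 : lscplus (fun _ : X => 0 : \bar R).
Proof.
split=> [x|x a a0]; first exact: lexx.
by exists setT => //; exact: filterT.
Qed.

Lemma lscplusD f g : lscplus f -> lscplus g -> lscplus (fun x => f x + g x).
Proof.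
move=> [f0 lf] [g0 lg]; split=> [x|x a]; first by rewrite adde_ge0.
move=> afg.
have [b [c [bf cg abc]]] : exists b c : R,
    [/\ b%:E < f x, c%:E < g x & (a <= b + c)%R].
  move: afg (f0 x) (g0 x); case: (f x) => [r| |]//;
    case: (g x) => [q| |]// afg r0 q0.
  - exists (r - (r + q - a) / 2)%R, (q - (r + q - a) / 2)%R.
    by move: afg; rewrite -EFinD !lte_fin; split; lra.
  - by exists (r - 1)%R, (a - (r - 1))%R; rewrite lte_fin ltry;
      split => //; lra.
  - by exists (a - (q - 1))%R, (q - 1)%R; rewrite lte_fin ltry;
      split => //; lra.
  - by exists a, 0%R; rewrite !ltry; split => //; lra.
have [V nV Vf] := lf _ _ bf; have [W nW Wg] := lg _ _ cg.
exists (V `&` W); first exact: filterI.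
move=> y [/Vf fy /Wg gy]; apply: (@le_lt_trans _ _ (b + c)%:E).
  by rewrite lee_fin.
by rewrite EFinD; exact: lteD.
Qed.

Lemma lscplusZ (s : R) f : (0 < s)%R -> lscplus f ->
  lscplus (fun x => s%:E * f x).
Proof.
move=> s0 [f0 lf]; split=> [x|x a]; first by rewrite mule_ge0// lee_fin ltW.
rewrite muleC -lte_pdivrMr// -EFinM => /lf[V nV Vf]; exists V => // y /Vf.
by rewrite EFinM lte_pdivrMr// muleC.
Qed.

Lemma lscplus_series (f : nat -> X -> \bar R) : (forall n, lscplus (f n)) ->
  lscplus (fun x => \sum_(n <oo) f n x).
Proof.
move=> lf; split=> [x|x a]; first by apply: nneseries_ge0 => n _ _;
  case: (lf n).
have lS N : lscplus (fun x => \sum_(n < N) f n x).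
  elim: N => [|N IH].
    by under [X in lscplus X]funext do rewrite big_ord0; exact: lscplus0.
  by under [X in lscplus X]funext do rewrite big_ord_recr/=; exact: lscplusD.
have f0 n y : 0 <= f n y by case: (lf n).
move=> aS; have [N aN] : exists N, a%:E < \sum_(n < N) f n x.
  apply: contrapT => nN; move: aS; apply/negP; rewrite -leNgt.
  apply: lime_le; first exact: is_cvg_nneseries.
  apply: nearW => N; rewrite leNgt; apply/negP => aN; apply: nN; exists N.
  by rewrite -(big_mkord xpredT (fun n => f n x)).
have [V nV VN] := (lS N).2 _ _ aN; exists V => // y /VN /lt_le_trans; apply.
rewrite -(big_mkord xpredT (fun n => f n y)).
exact: nneseries_lim_ge.
Qed.

End lsc.

(** * Continuity of the upper capacity along increasing sequences *)

Section upper_capacity.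
Context (R : realType) (X : ptopologicalType).
Hypothesis X_lc : locally_compact [set: X].
Hypothesis X_hausdorff : hausdorff_space X.
Variable G : X * X -> \bar R.
Implicit Types (p q h phi psi : X -> R) (f g u : X -> \bar R).
Implicit Types (mu nu lam : radon_measure R X).

Local Notation E1 := (energy_ball G).
Local Notation En := (mutual_energy G).

Lemma C0plusP f : C0plus f <-> exists2 p, ctest p & f = (fun x => (p x)%:E).
Proof.
split=> [[[f0 lf] [f_fin uf cK]]|[p tp ->]].
  have fE x : (fine (f x))%:E = f x.
    by rewrite fineK// ge0_fin_numE//; have /andP[] := f_fin x.
  exists (fine \o f); last by apply/funext => x /=; rewrite fE.
  split.
  - move=> x; apply/cvgrPdist_lt => e e0.
    have [|V nV Vf] := lf x (fine (f x) - e)%R.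
      by rewrite -[ltRHS]fE lte_fin; lra.
    have [|W nW Wf] := uf x (fine (f x) + e)%R.
      by rewrite -[ltLHS]fE lte_fin; lra.
    apply: filterS2 nV nW => y /Vf + /Wf.
    by rewrite -(fE y) !lte_fin ltr_norml /=; lra.
  - by move=> x /=; apply: fine_ge0.
  exists (closure [set x | f x != 0]) => // x nx /=.
  suff -> : f x = 0 by [].
  by apply: contrapT => /eqP fx; apply: nx; exact: subset_closure.
have [cp p0 _] := tp; split.
  by split=> [x|]; [rewrite lee_fin|exact: continuous_lsc].
split.
- by move=> x; rewrite lee_fin p0 ltry.
- move=> x a; rewrite lte_fin => pa.
  have e0 : (0 < a - p x)%R by lra.
  exists [set y | `|p x - p y| < a - p x]%R.
    by have /cvgrPdist_lt/(_ _ e0) := cp x.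
  by move=> y /=; rewrite lte_fin ltr_norml; lra.
- by have [_] := ctest_test_function X_hausdorff tp.
Qed.

Lemma cap_C0_le p (c : R) : ctest p ->
  cap_C0 G (fun x => (p x)%:E) <= c%:E <->
  forall mu, E1 mu -> (pairing p mu <= c)%R.
Proof.
move=> tp; split=> [H mu bmu|H].
  rewrite -lee_fin pairingE//; apply: le_trans H.
  by apply: ereal_sup_ubound; exists mu.
by apply: ge_ereal_sup => _ [mu bmu <-]; rewrite -pairingE// lee_fin; exact: H.
Qed.

Lemma cap_lsc_le g (c : R) : cap_lsc G g <= c%:E <-> ball_le G g c.
Proof.
split=> [H p tp pg|H].
  apply/(cap_C0_le _ tp); apply: le_trans H; apply: ereal_sup_ubound.
  exists (fun x => (p x)%:E) => //; split => //.
  by apply/C0plusP; exists p.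
apply: ge_ereal_sup => _ [_ [/C0plusP[p tp ->] pg] <-].
by apply/(cap_C0_le _ tp); exact: H.
Qed.

Lemma ball_le_integral g (c : R) mu : lscplus g -> ball_le G g c -> E1 mu ->
  \int[mu]_x g x <= c%:E.
Proof.
move=> [g0 lg] gc bmu; apply: lsc_integral_le => // p tp pg.
by rewrite -pairingE// lee_fin; exact: gc.
Qed.

Hypothesis G_kernel : is_kernel G.

(** The bound on means passes to the positive part of [g - psi], because the
    energy ball is stable under multiplying measures by functions with values
    between 0 and 1: multiplication by [h] localizes on the set where [phi],
    hence [g - psi], is positive. *)
Lemma ball_le_posB g psi (e : R) : Fplus g -> ctest psi ->
  (forall p, ctest p -> (forall x, (p x)%:E <= g x) ->
     forall mu, E1 mu -> (pairing p mu <= pairing psi mu + e)%R) ->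
  ball_le G (fun x => maxe (g x - (psi x)%:E) 0) e.
Proof.
move=> g0 tpsi gpsi phi tphi phig mu bmu.
have [cphi phi0 [K cK phiK]] := tphi; have [cpsi psi0 _] := tpsi.
have [q tq [q1 qK]] := @bump_on R X X_lc X_hausdorff _ cK.
set Q := pairing q mu; have Q0 : (0 <= Q)%R by exact: pairing_ge0.
apply/ler_addgt0Pr => e' e'0.
pose d := (e' / (2 * (Q + 1)))%R.
have Q1 : (0 < 2 * (Q + 1))%R by rewrite mulr_gt0// ltr_wpDl.
have d0 : (0 < d)%R by rewrite divr_gt0.
have dQ : (2 * d * Q <= e')%R.
  rewrite /d (_ : 2 * (e' / (2 * (Q + 1))) * Q = e' * (2 * Q) / (2 * (Q + 1)))%R; last by ring.
  by rewrite ler_pdivrMr// ler_wpM2l ?(ltW e'0)//; lra.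
clearbody d.
have cd : continuous (fun _ : X => d^-1)%R by move=> x; exact: cvg_cst.
have c1 : continuous (fun _ : X => 1 : R)%R by move=> x; exact: cvg_cst.
have cphid : continuous (fun x => Num.max (phi x - d) 0)%R.
  by have [] := ctest_posBc (ltW d0) tphi.
(* [k] is [1] where [h] does not vanish, so that [h * k = h], while [k] cuts
   [phi + psi] off outside the set where [phi] is positive. *)
pose h x := (Num.min (Num.max (phi x - d) 0 * d^-1) 1)%R.
pose k x := (Num.min (phi x * d^-1) 1)%R.
have ch : continuous h.
  apply: continuous_minr c1 => x.
  by apply: cvgM; [exact: cphid|exact: cd].
have ck : continuous k.
  by apply: continuous_minr c1 => x; apply: cvgM; [exact: cphi|exact: cd].
have h01 x : (0 <= h x <= 1)%R.
  rewrite /h le_min ler01 ge_min lexx orbT !andbT mulr_ge0 ?invr_ge0 ?(ltW d0)//.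
  by rewrite le_max lexx orbT.
have h0 x : (0 <= h x)%R by have /andP[] := h01 x.
have h1 x : (h x <= 1)%R by have /andP[] := h01 x.
have k0 x : (0 <= k x)%R.
  by rewrite /k le_min ler01 mulr_ge0 ?invr_ge0 ?(ltW d0).
have k1 x : (k x <= 1)%R by rewrite /k ge_min lexx orbT.
have hk x : (h x * k x = h x)%R.
  rewrite /h /k; have [pd|dp] := leP (phi x) d.
    have /max_idPr -> : (phi x - d <= 0)%R by lra.
    by rewrite mul0r (min_idPl ler01) mul0r.
  have -> : (Num.min (phi x * d^-1) 1 = 1)%R.
    by apply/min_idPr; rewrite ler_pdivlMr// mul1r ltW.
  by rewrite mulr1.
have d20 : (0 <= 2 * d)%R by rewrite mulr_ge0// ltW.
have q0 x : (0 <= q x)%R by exact: ctest_ge0.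
have phih x : (phi x <= h x * phi x + 2 * d * q x)%R.
  have [pd|dp] := leP (phi x) (2 * d)%R.
    have [/qK -> |/phiK ->] := pselect (K x).
      by have := phi0 x; have := h0 x; nra.
    by rewrite mulr0 add0r mulr_ge0.
  have -> : h x = 1%R.
    apply/min_idPr; rewrite ler_pdivlMr// mul1r.
    by rewrite le_max; apply/orP; left; lra.
  by rewrite mul1r lerDl mulr_ge0.
have [nu nuE] := radon_density X_lc X_hausdorff mu ch h0.
have bnu : E1 nu by exact: (energy_ball_density X_lc X_hausdorff G_kernel bmu ch h01 nuE).
have tphipsi := ctestD tphi tpsi.
have tk := ctestM tphipsi ck k0.
have kg x : (k x * (phi x + psi x))%:E <= g x.
  have [px|] := eqVneq (phi x) 0%R.
    by rewrite /k px mul0r (min_idPl ler01) mul0r; exact: g0.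
  move=> px; have {}px : (0 < phi x)%R by rewrite lt_def px phi0.
  have := phig x; rewrite le_max => /orP[|]; last first.
    by rewrite lee_fin leNgt px.
  rewrite leeBrDr// -EFinD; apply: le_trans; rewrite lee_fin.
  by rewrite ler_piMl// addr_ge0.
have := gpsi _ tk kg nu bnu; rewrite !nuE//.
have -> : (fun x => h x * (k x * (phi x + psi x)))%R =
    (fun x => h x * phi x + h x * psi x)%R.
  by apply/funext => x; rewrite mulrA hk mulrDr.
have thphi := ctestM tphi ch h0; have thpsi := ctestM tpsi ch h0.
rewrite pairingD// => H.
have tdq := ctestZ d20 tq.
have := pairing_le X_hausdorff mu tphi (ctestD thphi tdq) phih.
by rewrite pairingD// pairingZ// -/Q; lra.
Qed.

Hypothesis G_consistent : consistent G.

Lemma pairing_le_mutual_energy psi lam mu : ctest psi ->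
  (forall x, (psi x)%:E <= potential G lam x) -> E1 lam -> E1 mu ->
  (pairing psi mu <= En lam mu)%R.
Proof.
move=> tpsi psiP bl bm; rewrite -lee_fin pairingE// mutual_energyE//.
by apply: ctest_integral_le => //; exact: potential_lsc.
Qed.

Lemma cap_lsc_ge0 g : lscplus g -> 0 <= cap_lsc G g.
Proof.
move=> [g0 _]; have [mu bmu] := energy_ball0 X_lc X_hausdorff G_kernel.
apply: le_ereal_sup_tmp; exists (cap_C0 G (fun=> 0)).
  by exists (fun=> 0) => //; split => //; apply/C0plusP;
    exists (fun=> 0%R) => //;
    exact: ctest0.
by apply: ereal_sup_ubound; exists mu => //; rewrite integral0.
Qed.

(** Duality yields a measure [lam] whose potential, multiplied by [s], dominates
    a majorant [g] of [f] in the mean. Replacing the potential by a test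
    function [psi] below it makes the excess, the positive part of
    [g - s * psi], lower semicontinuous: it then has small capacity, and not
    merely small inner capacity. *)
Lemma upper_cap_split f (s e : R) : (0 < s)%R -> (0 < e)%R ->
  upper_cap G f < s%:E -> exists lam psi u, [/\ E1 lam,
    ctest psi /\ (forall x, (psi x)%:E <= potential G lam x),
    lscplus u, ball_le G u e & forall x, f x <= (s * psi x)%:E + u x].
Proof.
move=> s0 e0 /ereal_inf_lt[_ [g [lg fg] <-] /ltW /cap_lsc_le gs].
have [g0 _] := lg.
have [lam blam lamP] :=
  exists_dominating X_lc X_hausdorff G_kernel G_consistent g0 (ltW s0) gs.
have es0 : (0 < e / s)%R by rewrite divr_gt0.
have [psi [tpsi psiP lpsi]] :=
  exists_minorant X_lc X_hausdorff G_kernel G_consistent blam es0.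
have tspsi := ctestZ (ltW s0) tpsi.
exists lam, psi, (fun x => maxe (g x - (s * psi x)%:E) 0); split => //.
- by apply: lscplus_posB => //; case: tspsi.
- apply: ball_le_posB => // p tp pg mu bmu.
  apply: le_trans (lamP _ tp pg _ bmu) _; rewrite pairingZ ?(ltW s0)//.
  have : (s * En lam mu <= s * (pairing psi mu + e / s))%R.
    by rewrite ler_pM2l//; exact: lpsi.
  by rewrite mulrDr [(s * (e / s))%R]mulrC divfK// gt_eqF.
move=> x; apply: le_trans (fg x) _; rewrite addeC -leeBlDr//.
by rewrite le_max lexx.
Qed.

End upper_capacity.

Section increasing.
Context (R : realType) (X : ptopologicalType).
Hypothesis X_lc : locally_compact [set: X].
Hypothesis X_hausdorff : hausdorff_space X.
Variable G : X * X -> \bar R.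
Hypothesis G_kernel : is_kernel G.
Hypothesis G_consistent : consistent G.
Implicit Types (p q h phi psi th : X -> R) (f g u : X -> \bar R).
Implicit Types (mu nu lam : radon_measure R X).

Local Notation E1 := (energy_ball G).
Local Notation En := (mutual_energy G).

(** By symmetry and consistency, the mutual energy with a fixed [mu] is
    continuous in the other measure, so it passes to a cluster point. *)
Lemma energy_ball_cluster (lams : nat -> radon_measure R X) :
  (forall n, E1 (lams n)) ->
  exists2 lam, E1 lam & forall mu, E1 mu -> forall (e : R), (0 < e)%R ->
    forall k, exists2 n, (k <= n)%N & (En (lams n) mu < En lam mu + e)%R.
Proof.
move=> bl; apply: contrapT => nlam.
have [|m n|lam blam|k /(_ (lams k) (bl k))] :=
  @compact_directed (vague R X) E1 nat (fun k => [set lam |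
    forall n, (k <= n)%N -> lams n <> lam])
    (energy_ball_compact X_lc X_hausdorff G_kernel).
- exact: (inhabits 0%N).
- exists (maxn m n); split=> lam /= H j; rewrite geq_max => /andP[mj nj];
    exact: H.
- have [mu [bmu [e [e0 [k kP]]]]] : exists mu, E1 mu /\ exists e : R,
      (0 < e)%R /\ exists k, forall n, (k <= n)%N ->
      (En lam mu + e <= En (lams n) mu)%R.
    apply: contrapT => nmu; apply: nlam; exists lam => // mu bmu e e0 k.
    apply: contrapT => nn; apply: nmu; exists mu; split => //; exists e.
    split => //; exists k => n kn; rewrite leNgt; apply/negP => H.
    by apply: nn; exists n.
  exists k; have := mutual_energy_near G_consistent bmu blam e0.
  apply: filterS => nu nuP bnu n kn nnu.
  have := kP n kn; rewrite nnu; have := nuP bnu.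
  by rewrite !(mutual_energyC X_lc X_hausdorff G_kernel mu) ltr_norml; lra.
by move=> /(_ k (leqnn k)); exact.
Qed.

Hypothesis G_posdef : positive_definite G.

(** Positive definiteness bounds the capacity of the potential of [lam] by the
    energy norm of [lam]. *)
Lemma mutual_energy_le1 lam mu : E1 lam -> E1 mu -> (En lam mu <= 1)%R.
Proof.
move=> bl bm; rewrite -lee_fin mutual_energyE//.
apply: le_trans (G_posdef (energy_ball_finite bl) (energy_ball_finite bm)) _.
rewrite -[leRHS]mule1; apply: lee_pmul => //; exact: sqrte_ge0.
Qed.

(** The measures [lam n] attached to [f n] have a cluster point [lam]. Finite
    minima [th] of the test functions [psi n], [n >= k], still satisfy
    [f k <= s * th] up to the small functions [u n], but their means are
    bounded by those of the potential of [lam]; so [th] exceeds this potential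
    by a function of small capacity only. *)
Lemma upper_cap_sup (f_ : nat -> X -> \bar R) f (t : R) : (0 <= t)%R ->
  (forall m n x, (m <= n)%N -> f_ m x <= f_ n x) ->
  (forall n, upper_cap G (f_ n) <= t%:E) ->
  (forall x y, (forall n, f_ n x <= y) -> f x <= y) ->
  upper_cap G f <= t%:E.
Proof.
move=> t0 f_mono f_t f_sup; apply/lee_addgt0Pr => e e0.
pose s := (t + e / 3)%R; have s0 : (0 < s)%R by rewrite /s; lra.
pose eta := (e / 3)%R; have eta0 : (0 < eta)%R by rewrite /eta; lra.
pose ep n := (eta / (2 ^ n.+1)%:R)%R.
have ep0 n : (0 < ep n)%R by rewrite divr_gt0// ltr0n expn_gt0.
have /choice[lpu lpuP] n : exists z : radon_measure R X * (X -> R) * (X -> \bar R),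
    [/\ E1 z.1.1, ctest z.1.2 /\ (forall x, (z.1.2 x)%:E <= potential G z.1.1 x),
    lscplus z.2, ball_le G z.2 (ep n) & forall x,
      f_ n x <= (s * z.1.2 x)%:E + z.2 x].
  have [|lam [psi [u H]]] := @upper_cap_split R X X_lc X_hausdorff G G_kernel
    G_consistent (f_ n) s (ep n) s0 (ep0 n).
    by apply: le_lt_trans (f_t n) _; rewrite lte_fin /s; lra.
  by exists (lam, psi, u).
pose lams n := (lpu n).1.1; pose psis n := (lpu n).1.2; pose us n := (lpu n).2.
have bl n : E1 (lams n) by have [] := lpuP n.
have tpsi n : ctest (psis n) by have [_ []] := lpuP n.
have psiP n x : (psis n x)%:E <= potential G (lams n) x.
  by have [_ [_ +] _ _ _] := lpuP n; exact.
have lu n : lscplus (us n) by have [] := lpuP n.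
have u0 n x : 0 <= us n x by have [] := lu n.
have uc n : ball_le G (us n) (ep n) by have [] := lpuP n.
have fu n x : f_ n x <= (s * psis n x)%:E + us n x.
  by have [_ _ _ _ +] := lpuP n; exact.
have [lam blam lamP] := energy_ball_cluster bl.
pose U x := \sum_(n <oo) us n x.
have lU : lscplus U by exact: lscplus_series.
have uU n x : us n x <= U x.
  apply: le_trans (nneseries_lim_ge n.+1 _) => //.
  by rewrite big_nat_recr//= leeDr// sume_ge0.
pose de k := (ep k / (2 * s))%R.
have de0 k : (0 < de k)%R by rewrite divr_gt0// mulr_gt0.
have thk k : exists th, [/\ ctest th,
    forall x, f_ k x <= (s * th x)%:E + U x &
    forall mu, E1 mu -> (pairing th mu <= En lam mu + de k)%R].
  pose good th := ctest th /\ forall x, f_ k x <= (s * th x)%:E + U x.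
  have good_psi n : (k <= n)%N -> good (psis n).
    move=> kn; split => // x; apply: le_trans (f_mono _ _ x kn) _.
    by apply: le_trans (fu n x) _; rewrite leeD2l.
  have [|[p [tp fp]] [q [tq fq]]|mu bmu|[th [/= tth fth]] thP] :=
    @compact_directed (vague R X) E1 {th | good th} (fun z => [set mu |
      (pairing (sval z) mu <= En lam mu + de k)%R])
      (energy_ball_compact X_lc X_hausdorff G_kernel).
  - exact: (inhabits (exist _ _ (good_psi k (leqnn k)))).
  - have cq : continuous q by case: tq.
    have tpq : ctest (fun x => Num.min (p x) (q x)).
      by apply: ctest_min => // x; exact: ctest_ge0.
    have gg : good (fun x => Num.min (p x) (q x)).
      by split => // x; rewrite /Num.min; case: ifP.
    exists (exist _ _ gg); split=> mu /=; apply: le_trans;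
      apply: pairing_le => // x; by rewrite ge_min lexx ?orbT.
  - have d3 : (0 < de k / 3)%R by have := de0 k; lra.
    have [n kn nlt] := lamP mu bmu _ d3 k.
    (* Near [mu] a single [psi n] is enough: one for which [lams n] is close to
       [lam] in mutual energy with [mu]. *)
    exists (exist _ _ (good_psi n kn)) => /=.
    have := mutual_energy_near G_consistent blam bmu d3.
    apply: filterS2 (pairing_near X_hausdorff mu (tpsi n) d3) => nu pnu lnu bnu.
    have := pairing_le_mutual_energy X_lc X_hausdorff G_kernel G_consistent (tpsi n)
      (psiP n) (bl n) bmu.
    by have := lnu bnu; move: pnu; rewrite !ltr_norml; lra.
  by exists th.
have /choice[v vP] k : exists v : X -> \bar R, [/\ lscplus v,
    ball_le G v (2 * de k)%R &
    forall x, f_ k x <= s%:E * (potential G lam x + v x) + U x].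
  have [th [tth fth thP]] := thk k.
  have [psi [tps psP lps]] :=
    exists_minorant X_lc X_hausdorff G_kernel G_consistent blam (de0 k).
  have lth : lscplus (fun x => (th x)%:E).
    split=> [x|]; first by rewrite lee_fin ctest_ge0.
    by apply: continuous_lsc; case: tth.
  exists (fun x => maxe ((th x)%:E - (psi x)%:E) 0); split.
  - by apply: lscplus_posB => //; case: tps.
  - apply: ball_le_posB => //; first by case: lth.
    move=> p tp pth mu bmu.
    have := pairing_le X_hausdorff mu tp tth pth.
    have := thP mu bmu; have := lps mu bmu; lra.
  move=> x; apply: le_trans (fth x) _; rewrite leeD2r// EFinM.
  rewrite lee_pmul2l// (@le_trans _ _ ((psi x)%:E + maxe ((th x)%:E - (psi x)%:E) 0))//.
    by rewrite addeC -leeBlDr// le_max lexx.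
  by rewrite leeD2r.
pose V x := \sum_(n <oo) v n x.
have lv n : lscplus (v n) by have [] := vP n.
have lV : lscplus V by exact: lscplus_series.
have vV n x : v n x <= V x.
  have v0 m y : 0 <= v m y by have [+ _] := lv m; exact.
  apply: le_trans (nneseries_lim_ge n.+1 _) => //.
  by rewrite big_nat_recr//= leeDr// sume_ge0.
have lP : lscplus (potential G lam).
  by split; [exact: potential_ge0|exact: potential_lsc].
have lPV := lscplusD lP lV; have lsPV := lscplusZ s0 lPV.
pose g x := s%:E * (potential G lam x + V x) + U x.
have lg : lscplus g by exact: lscplusD.
have fg x : f x <= g x.
  apply: f_sup => k; have [_ _ +] := vP k => /(_ x) /le_trans; apply.
  by rewrite leeD2r// lee_pmul2l// leeD2l.
apply: (@le_trans _ _ (cap_lsc G g)); first by apply: ereal_inf_lbound;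
  exists g.
rewrite -EFinD; apply/(cap_lsc_le X_hausdorff) => p tp pg mu bmu.
have series_le (w : nat -> X -> \bar R) (c : R) : (0 <= c)%R ->
    (forall n, lscplus (w n)) ->
      (forall n, ball_le G (w n) (c / (2 ^ n.+1)%:R)%R) ->
    \int[mu]_x (\sum_(n <oo) w n x) <= c%:E.
  move=> c0 lw wc; rewrite integral_nneseries//; last 2 first.
  - by move=> n; apply: lsc_borel; case: (lw n).
  - by move=> n x _; case: (lw n).
  apply: le_trans (epsilon_trick0 xpredT c0);
    apply: lee_nneseries => [n _ _|n _].
    by apply: integral_ge0 => x _; case: (lw n).
  exact: ball_le_integral.
have IU : \int[mu]_x U x <= eta%:E by apply: series_le => //; exact: ltW.
have IV : \int[mu]_x V x <= (eta / s)%:E.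
  apply: series_le => //; first by rewrite divr_ge0 ?ltW.
  move=> n; have [_ + _] := vP n; congr (ball_le _ _ _).
  have : (2 ^ n.+1)%:R != 0%R :> R by rewrite pnatr_eq0 -lt0n expn_gt0.
  rewrite /de /ep; move: (_%:R) => q q0.
  by field; rewrite q0 gt_eqF.
have mP : measurable_fun [set: borel X] (potential G lam) by apply: lsc_borel;
  case: lP.
have mV : measurable_fun [set: borel X] V by apply: lsc_borel; case: lV.
have mU : measurable_fun [set: borel X] U by apply: lsc_borel; case: lU.
have mPV : measurable_fun [set: borel X] (fun x => potential G lam x + V x).
  by apply: lsc_borel; case: lPV.
have IP : \int[mu]_x potential G lam x <= 1.
  by rewrite -mutual_energyE// lee_fin; exact: mutual_energy_le1.
rewrite -lee_fin pairingE//.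
apply: le_trans (ctest_integral_le _ tp lg.2 pg) _.
have [P0 _] := lP; have [V0 _] := lV; have [U0 _] := lU.
rewrite ge0_integralD//; last 2 first.
- by move=> x _; case: lsPV.
- by apply: lsc_borel; case: lsPV.
rewrite ge0_integralZl//; last 2 first.
- by move=> x _; rewrite adde_ge0.
- by rewrite lee_fin ltW.
rewrite ge0_integralD//.
apply: (@le_trans _ _ (s%:E * (1 + (eta / s)%:E) + eta%:E)).
  by apply: leeD => //; rewrite lee_pmul2l//; exact: leeD.
rewrite [leLHS](_ : _ = (s * (1 + eta / s) + eta)%:E)//.
rewrite lee_fin mulrDr mulr1 [(s * (eta / s))%R]mulrC divfK ?gt_eqF//.
by rewrite /s /eta; lra.
Qed.

End increasing.

(** * Lower capacity and test functions *)

Section lower_capacity.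
Context (R : realType) (X : ptopologicalType).
Hypothesis X_lc : locally_compact [set: X].
Hypothesis X_hausdorff : hausdorff_space X.
Variable G : X * X -> \bar R.
Hypothesis G_kernel : is_kernel G.
Implicit Types (p q phi : X -> R) (f g u h : X -> \bar R).
Implicit Types (mu nu lam : radon_measure R X).

Local Notation E1 := (energy_ball G).

Lemma H0_ge0 h x : H0 h -> 0 <= h x.
Proof. by move=> [+ _ _] => /(_ x) /andP[]. Qed.

Lemma support_off h x : ~ closure [set y | h y != 0] x -> h x = 0.
Proof.
move=> nx; apply: contrapT => /eqP hx; apply: nx; exact: subset_closure.
Qed.

(** As [h] and [g] are semicontinuous in opposite directions, a multiple of a
    bump fits between [h - e] and [g] near each point of the support of [h];
    taking maxima glues such bumps together. *)
Lemma insertion h g (e : R) : H0 h -> lscplus g -> fle h g -> (0 < e)%R ->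
  exists p, [/\ ctest p, forall x, (p x)%:E <= g x &
    forall x, closure [set y | h y != 0] x -> h x <= (p x + e)%:E].
Proof.
move=> [h_fin uh cK] [g0 lg] hg e0.
pose good p := ctest p /\ forall x, (p x)%:E <= g x.
have [|[p [tp pg]] [q [tq qg]]|x0 _|[p [/= tp pg]] pK] :=
  @compact_directed X _ {p | good p} (fun z => [set x |
    h x <= (sval z x + e)%:E]) cK.
- have gg : good (fun=> 0%R) by split => //; exact: ctest0.
  exact: (inhabits (exist _ _ gg)).
- have gg : good (fun x => Num.max (p x) (q x)).
    split => [|x]; first exact: ctest_max.
    by rewrite EFin_max ge_max pg qg.
  exists (exist _ _ gg); split=> x /= /le_trans; apply.
    by rewrite lee_fin lerD2r le_max lexx.
  by rewrite lee_fin lerD2r le_max lexx orbT.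
- have [r hr] : exists r, h x0 = r%:E.
    exists (fine (h x0)); rewrite fineK// ge0_fin_numE//.
      by have /andP[] := h_fin x0.
    by have /andP[] := h_fin x0.
  pose c := (r - e / 2)%R.
  have oU : open [set x | c%:E < g x] by exact: (lower_semicontinuousP _).1.
  have Ux0 : [set x | c%:E < g x] x0.
    by apply: lt_le_trans (hg x0); rewrite hr lte_fin /c; lra.
  have [q [tq q1 [L [cL LU qL]]] nq] :=
    @bump_point R X X_lc X_hausdorff _ _ oU Ux0.
  have c0 : (0 <= Num.max c 0)%R by rewrite le_max lexx orbT.
  have gg : good (fun x => Num.max c 0 * q x)%R.
    split => [|x]; first exact: ctestZ.
    have [/LU/= cg|/qL ->] := pselect (L x); last by rewrite mulr0.
    apply: (@le_trans _ _ (Num.max c 0)%:E).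
      by rewrite lee_fin ler_piMr.
    by rewrite EFin_max ge_max g0 ltW.
  exists (exist _ _ gg) => /=.
  have [|V nV Vh] := uh x0 (r + e / 2)%R; first by rewrite hr lte_fin; lra.
  apply: filterS2 nV nq => y /Vh/ltW hy qy _; apply: le_trans hy _.
  rewrite qy mulr1 lee_fin.
  have : (c <= Num.max c 0)%R by rewrite le_max lexx.
  by rewrite /c; lra.
by exists p.
Qed.

Lemma cap_H0_le h g : H0 h -> lscplus g -> fle h g -> cap_H0 G h <= cap_lsc G g.
Proof.
move=> Hh lg hg; have [h_fin uh cK] := Hh.
have cap0 := cap_lsc_ge0 X_lc X_hausdorff G_kernel lg.
have [|cap_fin] := eqVneq (cap_lsc G g) +oo; first by move=> ->; rewrite leey.
have [c cE] : exists c : R, cap_lsc G g = c%:E.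
  exists (fine (cap_lsc G g)); rewrite fineK// ge0_fin_numE//.
  by rewrite ltey.
have [q tq [q1 qK]] := @bump_on R X X_lc X_hausdorff _ cK.
have [M M0 qM] := ball_bounded X_lc X_hausdorff G_kernel tq.
apply/lee_addgt0Pr => e e0.
pose d := (e / (M + 1))%R.
have d0 : (0 < d)%R by rewrite divr_gt0// ltr_wpDl.
have dM : (d * M <= e)%R.
  by rewrite /d mulrAC ler_pdivrMr ?ltr_wpDl// ler_wpM2l ?lerDl// ltW.
have [p [tp pg hp]] := insertion Hh lg hg d0.
have tdq := ctestZ (ltW d0) tq; have tpdq := ctestD tp tdq.
apply: (@le_trans _ _ (cap_C0 G (fun x => (p x + d * q x)%:E))).
  apply: ereal_inf_lbound; exists (fun x => (p x + d * q x)%:E) => //.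
  split; first by apply/(C0plusP X_hausdorff);
    exists (fun x => p x + d * q x)%R.
  move=> x; have [Kx|/support_off ->] := pselect (closure [set y | h y != 0] x).
    by rewrite (qK x Kx) mulr1; exact: hp.
  by rewrite lee_fin; exact: (ctest_ge0 x tpdq).
rewrite cE -EFinD; apply/(cap_C0_le X_hausdorff _ _ tpdq) => mu bmu.
rewrite pairingD// pairingZ ?(ltW d0)//; apply: lerD.
  by move: mu bmu; apply/(cap_lsc_le X_hausdorff G g c).1 => //; rewrite cE.
apply: le_trans dM; rewrite ler_pM2l// -lee_fin pairingE//; exact: qM.
Qed.

Lemma lower_cap_le f : lower_cap G f <= upper_cap G f.
Proof.
apply: ge_ereal_sup => _ [h [Hh hf] <-].
apply: le_ereal_inf_tmp => _ [g [lg fg] <-].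
by apply: cap_H0_le => // x; exact: le_trans (hf x) (fg x).
Qed.

Lemma lower_cap_ge0 f : Fplus f -> 0 <= lower_cap G f.
Proof.
move=> f0; apply: le_ereal_sup_tmp; exists (cap_H0 G (fun=> 0)).
  exists (fun=> 0) => //; split => //.
  have [] : C0plus (fun _ : X => 0 : \bar R) by
    apply/(C0plusP X_hausdorff); exists (fun=> 0%R) => //; exact: ctest0.
  by [].
apply: le_ereal_inf_tmp => _ [phi [/(C0plusP X_hausdorff)[p tp ->] _] <-].
have [mu bmu] := energy_ball0 X_lc X_hausdorff G_kernel.
apply: le_ereal_sup_tmp; exists (\int[mu]_x (p x)%:E); first by exists mu.
exact: ctest_integral_ge0.
Qed.

End lower_capacity.

(** * Choquet's capacitability argument *)

Section baire.

Definition baire : topologicalType := prod_topology (fun _ : nat => nat).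

Lemma baire_near (sigma : baire) n :
  \forall tau \near sigma, mkseq (tau : nat -> nat) n = mkseq sigma n.
Proof.
elim: n => [|n IH]; first exact: filterE.
have nn : \forall tau \near sigma, tau n = sigma n.
  exact: (@proj_continuous _ (fun _ : nat => nat) n sigma _ (discrete_set1 _)).
by apply: filterS2 IH nn => tau tn tn'; rewrite !mkseqS tn tn'.
Qed.

Lemma baire_box_compact (beta : nat -> nat) :
  compact ([set sigma | forall i, (sigma i <= beta i)%N] : set baire).
Proof.
apply: (@tychonoff _ (fun _ => nat) (fun i => [set k | (k <= beta i)%N])) => i.
apply: finite_compact; apply: (sub_finite_set _ (finite_II (beta i).+1)).
by move=> k /= kb; rewrite ltnS.
Qed.

End baire.

Section choquet.
Context (R : realType) (X : ptopologicalType).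
Hypothesis X_hausdorff : hausdorff_space X.
Variable h : seq nat -> X -> \bar R.
Hypothesis hH0 : forall s, s != [::] -> H0 (h s).
Implicit Types (p : X -> R) (sigma beta : nat -> nat) (b : seq nat).

Definition branch sigma x : \bar R :=
  ereal_inf [set h (mkseq sigma n) x | n in [set n | (1 <= n)%N]].

(** The Suslin scheme restricted to the branches whose first indices are bounded
    by the entries of [b]. *)
Definition suslin_below b x : \bar R := ereal_sup [set branch sigma x
  | sigma in [set sigma | forall i, (i < size b)%N -> (sigma i <= nth 0%N b i)%N]].

Definition suslin_box beta x : \bar R := ereal_sup [set branch sigma x
  | sigma in [set sigma | forall i, (sigma i <= beta i)%N]].

Let mkseq_neq0 sigma n : (1 <= n)%N -> mkseq sigma n != [::].
Proof. by case: n. Qed.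

Lemma branch_ge0 sigma x : 0 <= branch sigma x.
Proof.
apply: le_ereal_inf_tmp => _ [n n1 <-].
exact: (H0_ge0 _ (hH0 (mkseq_neq0 sigma n1))).
Qed.

Lemma branch_le sigma n x : (1 <= n)%N -> branch sigma x <= h (mkseq sigma n) x.
Proof. by move=> n1; apply: ereal_inf_lbound; exists n. Qed.

Lemma suslin_below_mono b k l x : (k <= l)%N ->
  suslin_below (rcons b k) x <= suslin_below (rcons b l) x.
Proof.
move=> kl; apply: ereal_sup_le => _ [sigma sb <-]; exists sigma => // i /=.
rewrite size_rcons => ib; have := sb i; rewrite size_rcons => /(_ ib).
rewrite !nth_rcons; case: ltnP => // _; case: eqP => // _ /leq_trans; exact.
Qed.

Lemma suslin_below_sup b x y :
  (forall k, suslin_below (rcons b k) x <= y) -> suslin_below b x <= y.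
Proof.
move=> H; apply: ge_ereal_sup => _ [sigma sb <-].
apply: le_trans (H (sigma (size b))); apply: ereal_sup_ubound.
exists sigma => // i /=; rewrite size_rcons ltnS leq_eqVlt => /orP[/eqP ->|ib].
  by rewrite nth_rcons ltnn eqxx.
by rewrite nth_rcons ib; exact: sb.
Qed.

Section box.
Variable beta : nat -> nat.

(** Off this compact set the first level of the scheme vanishes on the box. *)
Definition first_support : set X :=
  \bigcup_(i < (beta 0%N).+1) closure [set x | h [:: i] x != 0].

Lemma first_support_compact : compact first_support.
Proof.
rewrite /first_support bigcup_mkord; apply: bigsetU_compact => i _.
by have [] := @hH0 [:: nat_of_ord i] isT.
Qed.

Lemma branch_off sigma x : (sigma 0 <= beta 0)%N -> ~ first_support x ->
  branch sigma x = 0.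
Proof.
move=> s0 nx; apply/eqP; rewrite eq_le branch_ge0 andbT.
apply: le_trans (branch_le sigma x (leqnn 1)) _.
rewrite support_off// => cx; apply: nx; exists (sigma 0%N) => //=.
Qed.

Lemma suslin_box_ge0 x : 0 <= suslin_box beta x.
Proof.
apply: le_ereal_sup_tmp; exists (branch beta x); last exact: branch_ge0.
by exists beta => // i /=.
Qed.

(** Upper semicontinuity holds because the branches of the box form a compact
    set and each of them depends on finitely many indices at a time. *)
Lemma suslin_box_H0 : H0 (suslin_box beta).
Proof.
split.
- move=> x; rewrite suslin_box_ge0/=.
  apply: (@le_lt_trans _ _ (\sum_(i < (beta 0%N).+1) h [:: val i] x)).
    apply: ge_ereal_sup => _ [sigma sb <-].
    apply: le_trans (branch_le sigma x (leqnn 1)) _.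
    have s0 : (sigma 0 < (beta 0).+1)%N by rewrite ltnS; exact: sb.
    rewrite (bigD1 (Ordinal s0))//= leeDl// sume_ge0// => i _.
    exact: (H0_ge0 _ (hH0 _)).
  apply/lte_sum_pinfty => i _; have [+ _ _] := @hH0 [:: val i] isT.
  by move=> /(_ x) /andP[].
- move=> x a Ha; have [c Hc ca] : exists2 c : R, suslin_box beta x < c%:E &
    (c < a)%R.
    move: Ha (suslin_box_ge0 x); case: (suslin_box beta x) => [r| |]//.
    by rewrite lte_fin => ra r0; exists ((r + a) / 2)%R; rewrite ?lte_fin; lra.
  have [|V W|sigma sb|V Vbox] :=
    @compact_directed baire _ {V | nbhs x V} (fun z =>
    [set sigma : baire | forall y, sval z y -> branch sigma y < c%:E])
    (@baire_box_compact beta).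
  + exact: (inhabits (exist _ setT filterT)).
  + exists (exist _ (sval V `&` sval W) (filterI (svalP V) (svalP W))).
    by split=> sigma /= H y [Vy Wy]; exact: H.
  + have : branch sigma x < c%:E.
      by apply: le_lt_trans Hc; apply: ereal_sup_ubound; exists sigma.
    move=> /ereal_inf_lt[_ [n n1 <-] hc].
    have [_ uh _] := hH0 (mkseq_neq0 sigma n1).
    have [V nV Vh] := uh _ _ hc.
    exists (exist _ V nV) => /=; have := baire_near sigma n.
    apply: filterS => tau tauE _ y Vy; apply: le_lt_trans (Vh y Vy).
    by rewrite -tauE; exact: branch_le.
  exists (sval V); first exact: svalP.
  move=> y Vy; apply: (@le_lt_trans _ _ c%:E); last by rewrite lte_fin.
  by apply: ge_ereal_sup => _ [sigma sb <-]; apply: ltW; exact: Vbox.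
- apply: (subclosed_compact (@closed_closure _ _) first_support_compact).
  have clB := compact_closed X_hausdorff first_support_compact.
  rewrite [X in _ `<=` X]((closure_id _).1 clB);
    apply: closureS => x /= /eqP nx.
  apply: contrapT => nb; apply: nx; apply/eqP;
    rewrite eq_le suslin_box_ge0 andbT.
  apply: ge_ereal_sup => _ [sigma sb <-]; rewrite branch_off//; exact: sb.
Qed.

(** If [p] dominates all branches of the box, then by compactness of the product
    of the box with the common support, a level of the scheme suffices to see
    this up to [e]; branches below [mkseq beta n.+1] are moved into the box by
    truncation, which does not affect their first indices. *)
Lemma suslin_box_approx p (e : R) : ctest p -> (0 < e)%R ->
  (forall x, suslin_box beta x <= (p x)%:E) ->
  exists n, forall x, first_support x ->
    suslin_below (mkseq beta n.+1) x <= (p x + e)%:E.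
Proof.
move=> [cp p0 _] e0 Hp.
have [|m n|[sigma x] [/= sb Kx]|n nP] :=
  @compact_directed (baire * X)%type _ nat (fun n =>
    [set sx : baire * X | exists2 j, (1 <= j <= n.+1)%N &
      h (mkseq sx.1 j) sx.2 < (p sx.2 + e)%:E])
    (compact_setX (@baire_box_compact beta) first_support_compact).
- exact: (inhabits 0%N).
- exists (maxn m n); split=> sx /= [j /andP[j1 jn] hj]; exists j => //;
    by rewrite j1 (leq_trans jn)// ltnS ?leq_maxl ?leq_maxr.
- have : branch sigma x < (p x + e / 2)%:E.
    apply: (@le_lt_trans _ _ (p x)%:E); last by rewrite lte_fin; lra.
    by apply: le_trans (Hp x); apply: ereal_sup_ubound; exists sigma.
  move=> /ereal_inf_lt[_ [n n1 <-] hc]; exists n.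
  have [_ uh _] := hH0 (mkseq_neq0 sigma n1).
  have [V nV Vh] := uh _ _ hc.
  have e2 : (0 < e / 2)%R by lra.
  have /cvgrPdist_lt/(_ _ e2) np := cp x.
  exists ([set tau | mkseq tau n = mkseq sigma n],
          [set y | V y /\ (`|p x - p y| < e / 2)%R]) => /=.
    by split; [exact: baire_near|exact: filterI].
  move=> [tau y] /= [tauE [Vy py]] _; exists n; first by rewrite n1 leqnSn.
  rewrite tauE; apply: lt_trans (Vh y Vy) _.
  by rewrite lte_fin; move: py; rewrite ltr_norml; lra.
exists n => x Kx; apply: ge_ereal_sup => _ [sigma sb <-].
pose tau i := minn (sigma i) (beta i).
have [|j /andP[j1 jn] hj] := nP (tau, x) => /=.
  by split => // i; exact: geq_minr.
apply: le_trans (branch_le sigma x j1) _; apply: ltW.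
suff <- : mkseq tau j = mkseq sigma j by [].
apply: (@eq_from_nth _ 0%N); rewrite !size_mkseq// => i ij.
rewrite !nth_mkseq//; apply/minn_idPl.
have := sb i; rewrite size_mkseq nth_mkseq; last exact: leq_trans ij jn.
by apply; exact: leq_trans ij jn.
Qed.

End box.

End choquet.

Section capacitability.
Context (R : realType) (X : ptopologicalType).
Hypothesis X_lc : locally_compact [set: X].
Hypothesis X_hausdorff : hausdorff_space X.
Variable G : X * X -> \bar R.
Hypothesis G_kernel : is_kernel G.
Hypothesis G_consistent : consistent G.
Hypothesis G_posdef : positive_definite G.
Variable h : seq nat -> X -> \bar R.
Hypothesis hH0 : forall s, s != [::] -> H0 (h s).

(** The indices [beta n] are chosen one after the other: increasing the bound on
    the next index exhausts the current part of the scheme, so the upper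
    capacities of the parts so obtained cannot all be at most [t]. *)
Lemma exists_box (t : R) : (0 <= t)%R ->
  t%:E < upper_cap G (suslin_below h [::]) ->
  exists beta, forall n, t%:E < upper_cap G (suslin_below h (mkseq beta n)).
Proof.
move=> t0 tf.
have /choice[k kP] b : exists k, t%:E < upper_cap G (suslin_below h b) ->
    t%:E < upper_cap G (suslin_below h (rcons b k)).
  apply: contrapT => nk.
  have tb : t%:E < upper_cap G (suslin_below h b).
    rewrite ltNge; apply/negP => bt; apply: nk; exists 0%N.
    by rewrite ltNge bt.
  have : upper_cap G (suslin_below h b) <= t%:E.
    apply: (@upper_cap_sup R X X_lc X_hausdorff G G_kernel G_consistent G_posdef
      (fun k => suslin_below h (rcons b k))) => //.
    - by move=> m n x mn; exact: suslin_below_mono.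
    - move=> n; rewrite leNgt; apply/negP => tn; apply: nk; by exists n.
    - by move=> x y; exact: suslin_below_sup.
  by rewrite leNgt tb.
pose bs := fix bs n := if n is m.+1 then rcons (bs m) (k (bs m)) else [::].
exists (fun n => k (bs n)) => n.
suff -> : mkseq (fun n => k (bs n)) n = bs n.
  by elim: n => //= n IH; exact: kP.
by elim: n => // n IH; rewrite mkseqS IH.
Qed.

(** The function [suslin_box h beta] is a member of [H0] below [f]. A test
    function above it and of capacity less than [t] would, after adding a small
    multiple of a bump, dominate a truncated scheme and still have capacity at
    most [t], against the choice of [beta]. *)
Lemma upper_cap_suslin_le f :
  (forall x, f x = suslin_below h [::] x) -> Fplus f ->
  upper_cap G f <= lower_cap G f.
Proof.
move=> fE f0; have l0 := lower_cap_ge0 X_lc X_hausdorff G_kernel f0.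
rewrite leNgt; apply/negP => lu.
have [l lE] : exists l, lower_cap G f = l%:E.
  exists (fine (lower_cap G f)); rewrite fineK// ge0_fin_numE//.
  by rewrite (lt_le_trans lu)// leey.
rewrite lE in lu l0.
have [t lt tu] := lee_real_between lu.
have t0 : (0 <= t)%R by rewrite lee_fin in l0; exact: le_trans l0 (ltW lt).
have ffE : f = suslin_below h [::] by apply/funext.
rewrite ffE in tu.
have [beta bP] := exists_box t0 tu.
have HH := suslin_box_H0 X_hausdorff hH0 beta.
have Hf : fle (suslin_box h beta) f.
  by move=> x; rewrite fE; apply: ereal_sup_le => _ [sigma _ <-]; exists sigma.
have : t%:E <= cap_H0 G (suslin_box h beta).
  apply: le_ereal_inf_tmp => _ [_ [/(C0plusP X_hausdorff)[p tp ->] Hp] <-].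
  rewrite leNgt; apply/negP => pt.
  have cB := @first_support_compact R X h hH0 beta.
  have [q tq [q1 qB]] := @bump_on R X X_lc X_hausdorff _ cB.
  have [M M0 qM] := ball_bounded X_lc X_hausdorff G_kernel tq.
  have [c cp ct] : exists2 c : R, (forall mu, energy_ball G mu ->
      (pairing p mu <= c)%R) & (c < t)%R.
    have [mu0 bmu0] := energy_ball0 X_lc X_hausdorff G_kernel.
    have cp0 : 0 <= cap_C0 G (fun x => (p x)%:E).
      apply: le_ereal_sup_tmp; exists (\int[mu0]_x (p x)%:E);
        first by exists mu0.
      exact: ctest_integral_ge0.
    have cpE : (fine (cap_C0 G (fun x => (p x)%:E)))%:E = cap_C0 G (fun x => (p x)%:E).
      by rewrite fineK// ge0_fin_numE// (lt_trans pt)// ltry.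
    exists (fine (cap_C0 G (fun x => (p x)%:E))).
      by apply/(cap_C0_le X_hausdorff _ _ tp); rewrite cpE.
    by rewrite -lte_fin cpE.
  pose d := ((t - c) / (M + 1))%R.
  have d0 : (0 < d)%R by rewrite divr_gt0 ?subr_gt0// ltr_wpDl.
  have dM : (d * M <= t - c)%R.
    rewrite /d mulrAC ler_pdivrMr ?ltr_wpDl// ler_wpM2l ?lerDl//.
    by rewrite subr_ge0 ltW.
  have [n nP] := suslin_box_approx hH0 tp d0 Hp.
  have tdq := ctestZ (ltW d0) tq; have tpdq := ctestD tp tdq.
  have := bP n.+1; apply/negP; rewrite -leNgt.
  apply: (@le_trans _ _ (cap_lsc G (fun x => (p x + d * q x)%:E))).
    apply: ereal_inf_lbound; exists (fun x => (p x + d * q x)%:E) => //; split.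
      split=> [x|]; first by rewrite lee_fin; exact: (ctest_ge0 x tpdq).
      by apply: continuous_lsc; case: tpdq.
    move=> x; have [Bx|nBx] := pselect (first_support h beta x).
      by rewrite (qB x Bx) mulr1; exact: nP.
    apply: (@le_trans _ _ 0); last by rewrite lee_fin;
      exact: (ctest_ge0 x tpdq).
    apply: ge_ereal_sup => _ [sigma sb <-].
    by rewrite (branch_off hH0 _ nBx)//; exact: (sb 0%N).
  apply/(cap_lsc_le X_hausdorff) => r tr rp mu bmu.
  apply: le_trans (pairing_le X_hausdorff mu tr tpdq rp) _.
  rewrite pairingD// pairingZ ?(ltW d0)//.
  have := cp mu bmu.
  have : (d * pairing q mu <= d * M)%R.
    by rewrite ler_pM2l// -lee_fin pairingE//; exact: qM.
  by lra.
apply/negP; rewrite -ltNge; apply: (@le_lt_trans _ _ l%:E);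
  last by rewrite lte_fin.
by rewrite -lE; apply: ereal_sup_ubound; exists (suslin_box h beta).
Qed.

End capacitability.

Theorem theorem3p17 (R : realType) (X : ptopologicalType)
  (X_lc : locally_compact [set: X]) (X_hausdorff : hausdorff_space X)
  (G : X * X -> \bar R) (G_kernel : is_kernel G)
  (G_consistent : consistent G) (G_posdef : positive_definite G)
  (f : X -> \bar R) (f_ge0 : Fplus f) (f_Suslin : H0_Suslin f) :
  upper_cap G f = lower_cap G f.
Proof.
apply/eqP; rewrite eq_le; apply/andP; split; last exact: lower_cap_le.
have [h [hH0 fE]] := f_Suslin.
apply: (upper_cap_suslin_le X_lc X_hausdorff G_kernel G_consistent G_posdef hH0) => // x.
rewrite fE /suslin_below; congr (ereal_sup (_ @` _)).
by apply/seteqP; split.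
Qed.
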